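(* For $\lambda\in\mathbb C$ and $m=0,1,2,\ldots$, let $J_{m+\frac12}(\lambda)$ denote the half-order Bessel function, i.e. $$J_{m+\frac12}(\lambda)=\frac1\pi\int_0^\pi\cos\left(\left(m+\tfrac12\right)\tau-\lambda\sin\tau\right)d\tau+\frac{(-1)^{m+1}}{\pi}\int_0^\infty\exp\left(-\lambda\sinh\tau-\left(m+\tfrac12\right)\tau\right)d\tau,\qquad \lambda\in\mathbb C,\quad m=0,1,2,\ldots.$$ Then $$J_{m+\frac12}(0)=0,\qquad m=0,1,2,\ldots,$$ and $J_{m+\frac12}(\lambda)$ admits the following explicit representation: $$J_{m+\frac12}(\lambda)=\frac{1}{\sqrt{2\pi}}\sum_{n=1}^{m+1}\beta_n^m\left[\frac{e^{i\lambda}}{i^{\,n-m}\lambda^{n-\frac12}}+(-1)^{n+m}\frac{e^{-i\lambda}}{i^{\,n-m}\lambda^{n-\frac12}}\right],\qquad \lambda\in\mathbb C\setminus\{0\},\quad m=0,1,2,\ldots,$$ where the coefficients $\beta_n^m$ are defined as follows: (i) $\beta_1^m=1$ if $m$ is even; (ii) for $n=3,5,\ldots,m+1$ if $m$ is even, and for $n=2,4,\ldots,m+1$ if $m$ is odd, $$\beta_n^m=\left((m+n)\binom{\frac{m+n-3}{2}}{n-1}+\binom{\frac{m+n-3}{2}}{n-2}\right)R_{\frac{m-n+3}{2},\,\frac{m+n-3}{2}}(m);$$ (iii) for $n=2,4,\ldots,m$ if $m$ is even, and for $n=1,3,\ldots,m$ if $m$ is odd, $$\beta_n^m=-\binom{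\frac{m+n}{2}-1}{n-1}R_{\frac{m-n}{2}+1,\,\frac{m+n}{2}-1}(m).$$
   Context: The notation used in the coefficients $\beta_n^m$ is $$R_{s,t}(r)=\begin{cases}\displaystyle\prod_{k=s}^{t}\bigl(2(r-k)+1\bigr),& s\le t,\\ 1,& s>t,\end{cases}\qquad \binom{s}{t}=\begin{cases}\dfrac{s!}{(s-t)!\,t!},& s\ge t,\\ 0,& s<t.\end{cases}$$
   Formalization: The second integral diverges for Re λ < 0, so the integral formula is taken as the definition of J_{m+1/2}(λ) only for Re λ ≥ 0; for Re λ < 0, J_{m+1/2} is its principal-branch analytic continuation (cut along the negative real axis). *)

(* Defs.v *)
From HB Require Import structures.
From mathcomp Require Export all_boot all_order all_algebra.
From mathcomp Require Export all_classical all_reals all_analysis.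
From mathcomp Require Export complex.

Set Implicit Arguments.
Unset Strict Implicit.
Unset Printing Implicit Defensive.

Export Order.TTheory GRing.Theory Num.Theory.
Export numFieldNormedType.Exports.

Global Open Scope classical_set_scope.
Global Open Scope ring_scope.
Global Open Scope complex_scope.

Local Notation Re := complex.Re.
Local Notation Im := complex.Im.

Definition expc (R : realType) (z : R[i]) : R[i] :=
  (expR (Re z) * cos (Im z)) +i* (expR (Re z) * sin (Im z)).

Definition cosc (R : realType) (z : R[i]) : R[i] :=
  (expc ('i%C * z) + expc (- ('i%C * z))) / 2.

Definition sinhr (R : realType) (t : R) : R := (expR t - expR (- t)) / 2.

Definition cintegral (R : realType) (D : set R) (f : R -> R[i]) : R[i] :=
  (\int[lebesgue_measure]_(t in D) Re (f t)) +i*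
  (\int[lebesgue_measure]_(t in D) Im (f t)).

(* Principal value of z ^ (k + 1/2), that is exp ((k + 1/2) (ln |z| + i arg z))
   with - pi < arg z <= pi: [sqrtc] is the square root with nonnegative real
   part, and sqrtc (- x) = 'i * sqrtc x for x > 0.                            *)
Definition half_pow (R : realType) (z : R[i]) (k : nat) : R[i] :=
  sqrtc z ^+ k.*2.+1.

(* The integral formula for J_{m+1/2}(z). Both integrands are Lebesgue
   integrable when 0 <= Re z; the second integral diverges when Re z < 0.     *)
Definition schlafli (R : realType) (m : nat) (z : R[i]) : R[i] :=
  (pi^-1)%:C *
    cintegral `[0, pi]
      (fun t => cosc (((m%:R + 2^-1) * t)%:C - z * (sin t)%:C)) +
  (-1) ^+ m.+1 * (pi^-1)%:C *
    cintegral `[0, +oo[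
      (fun t => expc (- (z * (sinhr t)%:C) - ((m%:R + 2^-1) * t)%:C)).

(* Sum of a power series converging on the whole complex plane. *)
Definition entire (R : realType) (E : R[i] -> R[i]) : Prop :=
  exists a : nat -> R[i],
    forall z : R[i],
      series (fun k => a k * z ^+ k : R[i]^o) @ \oo --> (E z : R[i]^o).

(* The entire function z ^ (- (m + 1/2)) J_{m+1/2}(z): the only one that is
   given by the integral formula on the open right half-plane.                *)
Definition bessel_entire (R : realType) (m : nat) : R[i] -> R[i] :=
  xget (fun=> 0)
    [set E : R[i] -> R[i] | entire E /\
       forall z : R[i], 0 < Re z -> schlafli m z = half_pow z m * E z].

(* J_{m+1/2}(z), principal branch, on the whole complex plane: the integral
   formula wherever it converges, and its analytic continuation (cut along the
   negative real axis, continuous from above there) on Re z < 0.              *)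
Definition besselJ_half (R : realType) (m : nat) (z : R[i]) : R[i] :=
  if 0 <= Re z then schlafli m z else half_pow z m * bessel_entire m z.

(* The range is empty, so the product is 1, when t < s. *)
Definition Rprod (s t r : nat) : int :=
  \prod_(s <= k < t.+1) (2 * (r%:Z - k%:Z) + 1).

(* beta_coef m n is the coefficient beta_n^m, meaningful for 1 <= n <= m + 1.
   The case "m even, n odd >= 3, or m odd, n even" is m + n odd and n > 1, the
   case "m, n both even or both odd" is m + n even. For n in this range, no
   subtraction is truncated and all halvings are exact.                       *)
Definition beta_coef (m n : nat) : int :=
  if ~~ odd m && (n == 1)%N then 1
  else if odd (m + n) then
    (((m + n) * 'C((m + n - 3)./2, n - 1) + 'C((m + n - 3)./2, n - 2))%N)%:Z *
    Rprod (m + 3 - n)./2 (m + n - 3)./2 m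
  else
    - ('C((m + n)./2 - 1, n - 1))%:Z *
    Rprod ((m - n)./2 + 1) ((m + n)./2 - 1) m.

(* Main.v *)
Require Import Defs.
From mathcomp Require Import ring lra zify measurable_realfun.

(** The integral formula can be evaluated in closed form because its integrands
are restrictions of one differential form to three curves. Put n = m + 1 and
  omega_n = exp (z / 2 (v^2 - v^-2)) v^(-2n) dv.
Along v = exp (i t / 2) and v = exp (- i t / 2), for t in [0, pi], it gives the
two halves of the cosine integral, and along v = i exp (t / 2), for t >= 0, it
gives the second integral. The identity
  z / 2 (v^2 - v^-2) = e i z + z / 2 (v - e i / v)^2,   e = 1 or e = - 1,
shows that omega_0 and omega_1 are combinations of two Gaussian differentials
exp (z y^2 / 2) dy, with y = v - i / v and y = v + i / v; hence they have the
explicit primitives of [schlafli_prim], expressed with the entire function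
[gauss_prim]. Integrating exp (z / 2 (v^2 - v^-2)) v^(-2n-1) by parts extends the
primitives to all n and is, at the same time, the three-term recurrence of the
Bessel functions. The primitive is odd in v, so that the contributions of the
common end points v = i and v = - i cancel and only the limit at infinity along
v = i exp (t / 2) is left. By the Gaussian integral this limit is a multiple of
[hbessel z n], which is sqrt (2 pi z) J_(n - 1/2) (z): it starts with 2 cos z and
2 sin z and obeys the recurrence ([schlafli_prim_cvg], [schlafli_hbessel]). The
estimates hold on the closed half-plane 0 <= Re z, up to the imaginary axis.

The recurrence turns [hbessel] into e^(i z) and e^(- i z) times Bessel polynomials
in i / z and - i / z ([hbessel_poly]), whose coefficients are, up to sign, the
numbers beta_n^m ([beta_coefE]).

For Re z < 0 the function J is defined by continuation. The same recurrence,
applied to Taylor coefficients, shows that hbessel z n / z^n extends to an entire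
function ([hbessel_entire_power_series]), and a power series that vanishes on the
positive real axis is zero; hence this extension is the continuation
([bessel_entireE]), and the representation holds there too. *)

Set Implicit Arguments.
Unset Strict Implicit.
Unset Printing Implicit Defensive.

Local Notation Re := complex.Re.
Local Notation Im := complex.Im.
Local Notation nrm := Normc.normc.

(** * The complex exponential and curves in the complex plane *)

Section ComplexExp.
Variable R : realType.
Implicit Types (z w : R[i]) (x y : R).

Lemma ReD z w : Re (z + w) = Re z + Re w. Proof. by case: z w => a b []. Qed.
Lemma ImD z w : Im (z + w) = Im z + Im w. Proof. by case: z w => a b []. Qed.
Lemma ReN z : Re (- z) = - Re z. Proof. by case: z. Qed.
Lemma ImN z : Im (- z) = - Im z. Proof. by case: z. Qed.
Lemma ReM z w : Re (z * w) = Re z * Re w - Im z * Im w.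
Proof. by case: z w => a b []. Qed.
Lemma ImM z w : Im (z * w) = Re z * Im w + Im z * Re w.
Proof. by case: z w => a b []. Qed.
Definition ReImE := (ReD, ImD, ReN, ImN, ReM, ImM).

Lemma complex_ext z w : Re z = Re w -> Im z = Im w -> z = w.
Proof. by case: z w => a b [c d] /= -> ->. Qed.

Lemma nrmE z : (nrm z)%:C = `|z|. Proof. by rewrite normc_def; case: z. Qed.
Lemma nrm_ge0 z : 0 <= nrm z. Proof. by case: z => a b; rewrite sqrtr_ge0. Qed.
Lemma nrmM z w : nrm (z * w) = nrm z * nrm w. Proof. exact: Normc.normcM. Qed.
Lemma nrmD z w : nrm (z + w) <= nrm z + nrm w. Proof. exact: le_normcD. Qed.
Lemma nrmN z : nrm (- z) = nrm z. Proof. exact: normcN. Qed.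
Lemma nrmV z : nrm z^-1 = (nrm z)^-1. Proof. exact: Normc.normcV. Qed.
Lemma nrm0 : nrm (0 : R[i]) = 0. Proof. exact: Normc.normc0. Qed.
Lemma nrm1 : nrm (1 : R[i]) = 1. Proof. exact: Normc.normc1. Qed.
Lemma nrm_eq0 z : (nrm z == 0) = (z == 0).
Proof. by rewrite -(inj_eq (@complexI R)) nrmE normr_eq0. Qed.
Lemma nrm_gt0 z : (0 < nrm z) = (z != 0).
Proof. by rewrite lt_def nrm_ge0 andbT nrm_eq0. Qed.
Lemma nrmX z n : nrm (z ^+ n) = nrm z ^+ n.
Proof. by elim: n => [|n IH]; rewrite ?nrm1 // !exprS nrmM IH. Qed.
Lemma nrm_real x : nrm x%:C = `|x|.
Proof. by rewrite /= expr0n addr0 sqrtr_sqr. Qed.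
Lemma nrm_i : nrm ('i%C : R[i]) = 1.
Proof. by rewrite /= expr0n add0r expr1n sqrtr1. Qed.
Lemma nrmB z w : nrm (z - w) = nrm (w - z). Proof. by rewrite -nrmN opprB. Qed.

Lemma Re_le_nrm z : `|Re z| <= nrm z.
Proof. by case: z => a b /=; rewrite -sqrtr_sqr ler_wsqrtr// lerDl sqr_ge0. Qed.
Lemma Im_le_nrm z : `|Im z| <= nrm z.
Proof. by case: z => a b /=; rewrite -sqrtr_sqr ler_wsqrtr// lerDr sqr_ge0. Qed.
Lemma nrm_le_ReIm z : nrm z <= `|Re z| + `|Im z|.
Proof.
rewrite [z in leLHS]complexE (le_trans (nrmD _ _))// nrmM nrm_i mul1r.
by rewrite !nrm_real.
Qed.

Lemma expcD z w : expc (z + w) = expc z * expc w.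
Proof.
apply: complex_ext; rewrite /expc !ReImE /= expRD ?cosD ?sinD; ring.
Qed.

Lemma expc0 : expc (0 : R[i]) = 1.
Proof. by rewrite /expc /= expR0 cos0 sin0 mulr0 mulr1. Qed.

Lemma expc_real x : expc x%:C = (expR x)%:C.
Proof. by rewrite /expc /= cos0 sin0 mulr0 mulr1. Qed.

Lemma nrm_expc z : nrm (expc z) = expR (Re z).
Proof.
rewrite /expc /= !exprMn -mulrDr cos2Dsin2 mulr1 sqrtr_sqr ger0_norm //.
Qed.

Lemma expc_neq0 z : expc z != 0.
Proof. by rewrite -nrm_gt0 nrm_expc expR_gt0. Qed.

Lemma expcN z : expc (- z) = (expc z)^-1.
Proof.
by apply: (mulfI (expc_neq0 z)); rewrite -expcD subrr expc0 divff ?expc_neq0.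
Qed.

Lemma expcMn z n : expc (z *+ n) = expc z ^+ n.
Proof. by elim: n => [|n IH]; rewrite ?mulr0n ?expc0// mulrS expcD IH exprS. Qed.

Lemma expc_ipi2 : expc ('i%C * (pi / 2)%:C) = 'i%C :> R[i].
Proof.
apply: complex_ext; rewrite /expc !ReImE /=.
  by rewrite !mul0r mulr0 subr0 mul1r add0r cos_pihalf mulr0.
by rewrite !mul0r mulr0 subr0 mul1r add0r sin_pihalf expR0 mulr1.
Qed.
End ComplexExp.

Section ComplexDerivative.
Variable R : realType.
Implicit Types (f g df dg : R -> R[i]).

(** Differentiation is componentwise because R[i] is a normed module over itself
and not over R, whereas the integration variables are real. *)
Definition cderiv f df := forall t : R,
  is_derive t (1 : R) (fun s => Re (f s)) (Re (df t)) /\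
  is_derive t (1 : R) (fun s => Im (f s)) (Im (df t)).

Definition ccontinuous f :=
  continuous (fun s => Re (f s)) /\ continuous (fun s => Im (f s)).

Lemma cderiv_continuous f df : cderiv f df -> ccontinuous f.
Proof.
by move=> fD; split=> t; have [[? _] [? _]] := fD t;
  apply: differentiable_continuous; apply/derivable1_diffP.
Qed.

Lemma cderiv_ext f g df dg : f =1 g -> df =1 dg -> cderiv f df -> cderiv g dg.
Proof. by move=> /funext <- /funext <-. Qed.

Lemma cderiv_cst c : cderiv (fun=> c) (fun=> 0).
Proof. by move=> t; split; exact: is_derive_cst. Qed.

Lemma cderiv_id : cderiv (fun t => t%:C) (fun=> 1).
Proof. by move=> t; split; [exact: is_derive_id | exact: is_derive_cst]. Qed.

Lemma cderivD f g df dg : cderiv f df -> cderiv g dg ->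
  cderiv (fun t => f t + g t) (fun t => df t + dg t).
Proof.
move=> fD gD t; have [rf mf] := fD t; have [rg mg] := gD t.
rewrite !ReImE; split; under eq_fun do rewrite ReImE; exact: is_deriveD.
Qed.

Lemma cderivM f g df dg : cderiv f df -> cderiv g dg ->
  cderiv (fun t => f t * g t) (fun t => df t * g t + f t * dg t).
Proof.
move=> fD gD t; have [rf mf] := fD t; have [rg mg] := gD t.
rewrite !ReImE; split; under eq_fun do rewrite ReImE; apply: is_derive_eq.
  by rewrite /GRing.scale /=; ring.
by rewrite /GRing.scale /=; ring.
Qed.

Lemma cderivZ c f df : cderiv f df -> cderiv (fun t => c * f t) (fun t => c * df t).
Proof.
move=> fD; apply: cderiv_ext (cderivM (cderiv_cst c) fD) => t //.
by rewrite mul0r add0r.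
Qed.

Lemma cderivN f df : cderiv f df -> cderiv (fun t => - f t) (fun t => - df t).
Proof.
by move=> /(cderivZ (-1)); apply: cderiv_ext => t; rewrite mulN1r.
Qed.

Lemma cderivB f g df dg : cderiv f df -> cderiv g dg ->
  cderiv (fun t => f t - g t) (fun t => df t - dg t).
Proof. by move=> fD /cderivN; exact: cderivD. Qed.

Lemma cderivX f df n : cderiv f df ->
  cderiv (fun t => f t ^+ n) (fun t => n%:R * f t ^+ n.-1 * df t).
Proof.
move=> fD; elim: n => [|n IH].
  by apply: cderiv_ext (cderiv_cst 1) => t //; rewrite !mul0r.
apply: cderiv_ext (cderivM fD IH) => t /=; first by rewrite exprS.
by case: n {IH} => [|n] /=; rewrite ?expr0 -?natr1 ?exprS; ring.
Qed.

Lemma cderiv_expc f df : cderiv f df ->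
  cderiv (fun t => expc (f t)) (fun t => expc (f t) * df t).
Proof.
move=> fD t; have [rf mf] := fD t.
rewrite !ReImE /=; split; apply: is_derive_eq.
  by rewrite /GRing.scale /=; ring.
by rewrite /GRing.scale /=; ring.
Qed.

End ComplexDerivative.

(** * Integration of complex-valued functions *)

Section Integral.
Variable R : realType.
Implicit Types (f df F : R -> R[i]) (a b : R).
Local Notation mu := (@lebesgue_measure R).

Lemma Rintegral_FTC (g G : R -> R) a b : a < b -> continuous g ->
  (forall t : R, is_derive t (1 : R) G (g t)) ->
  \int[mu]_(t in `[a, b]) g t = G b - G a.
Proof.
move=> ab cg GD.
have cG : continuous G.
  by move=> t; apply: differentiable_continuous; apply/derivable1_diffP.
rewrite /Rintegral (@continuous_FTC2 _ g G) //.
- exact: continuous_subspaceT.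
- split=> [t _ //||].
  + by apply: cvg_at_right_filter; exact: cG.
  + by apply: cvg_at_left_filter; exact: cG.
- by move=> t _; rewrite derive1E derive_val.
Qed.

Lemma cintegral_FTC F f a b : a < b -> ccontinuous f -> cderiv F f ->
  cintegral `[a, b] f = F b - F a.
Proof.
move=> ab [crf cmf] FD; rewrite /cintegral.
rewrite (Rintegral_FTC ab crf (fun t => (FD t).1)).
rewrite (Rintegral_FTC ab cmf (fun t => (FD t).2)).
by apply: complex_ext; rewrite !ReImE.
Qed.

(** Adding the dominating exponential makes the integrand nonnegative; then monotone
convergence gives the improper fundamental theorem. *)
Lemma Rintegral_FTCy (g G : R -> R) (c l : R) : 0 < c -> continuous g ->
  (forall t : R, is_derive t (1 : R) G (g t)) ->
  (forall t, 0 <= t -> `|g t| <= expR (- (c * t))) ->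
  G t @[t --> +oo] --> l ->
  \int[mu]_(t in `[0, +oo[) g t = l - G 0.
Proof.
move=> c0 cg GD gle Gl.
pose h (t : R) := expR (- (c * t)).
pose H (t : R) := - c^-1 * h t.
have cn0 : c != 0 by rewrite gt_eqF.
have HD t : is_derive t (1 : R) H (h t).
  apply: is_derive_eq; rewrite /GRing.scale /= /h; field.
  exact: cn0.
have cts (f df : R -> R) : (forall t : R, is_derive t (1 : R) f (df t)) -> continuous f.
  by move=> fD t; apply: differentiable_continuous; apply/derivable1_diffP.
have ch : continuous h by apply: (@cts _ (fun t => - c * h t)) => t; apply: is_derive_eq;
  rewrite /GRing.scale /= /h; ring.
have H0 : H t @[t --> +oo] --> (0 : R).
  rewrite -[0](mulr0 (- c^-1)); apply: cvgM; first exact: cvg_cst.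
  apply: (@cvg_comp _ _ _ (fun t => c * t) (fun t => expR (- t))).
    2: exact: cvgr_expR.
  exact: gt0_cvgMry.
have intE (f F : R -> R) L : (forall t, 0 <= t -> 0 <= f t) ->
    (forall t : R, is_derive t (1 : R) F (f t)) -> continuous f ->
    F t @[t --> +oo] --> L ->
    (\int[mu]_(t in `[0%R, +oo[) (f t)%:E = L%:E - (F 0)%:E)%E.
  move=> f0 FD cf FL; apply: ge0_continuous_FTC2y => //.
  - exact: continuous_subspaceT.
  - by apply: cvg_at_right_filter; exact: (cts _ f).
  - by move=> t _; rewrite derive1E derive_val.
have mg : measurable_fun (`[0, +oo[%classic : set R) g.
  by apply: measurable_funTS; exact: continuous_measurable_fun.
have mh : measurable_fun (`[0, +oo[%classic : set R) h.
  by apply: measurable_funTS; exact: continuous_measurable_fun.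
have ih : mu.-integrable `[0, +oo[ (EFin \o h).
  apply/integrableP; split; first exact/measurable_EFinP.
  under eq_integral do rewrite /= ger0_norm ?expR_ge0//.
  by rewrite (intE _ H 0)//; [exact: ltry|move=> t _; exact: expR_ge0].
have ig : mu.-integrable `[0, +oo[ (EFin \o g).
  apply: le_integrable ih => //; first exact/measurable_EFinP.
  move=> t /=; rewrite in_itv/= andbT => t0.
  by rewrite lee_fin [leRHS]ger0_norm ?expR_ge0// gle.
have : \int[mu]_(t in `[0, +oo[) (g t + h t) = l + 0 - (G 0 + H 0).
  rewrite /Rintegral (intE _ (fun t => G t + H t) (l + 0)) //.
  - by move=> t t0; rewrite -lerBlDr sub0r; move: (gle _ t0); rewrite ler_norml => /andP[].
  - by move=> t; apply: cvgD; [exact: cg|exact: ch].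
  - exact: cvgD.
have ihE : \int[mu]_(t in `[0, +oo[) h t = 0 - H 0.
  by rewrite /Rintegral (intE _ H 0)// => t _; exact: expR_ge0.
rewrite RintegralD // ihE => /(canRL (addrK _)) ->; ring.
Qed.

Lemma cvg0_dominated {T : Type} (Fi : set_system T) {FF : Filter Fi} (u v : T -> R) :
  (\forall t \near Fi, `|u t| <= v t) -> v t @[t --> Fi] --> 0 ->
  u t @[t --> Fi] --> 0.
Proof.
move=> uv v0; apply: (@squeeze_cvgr _ _ _ _ (fun t => - v t) v) => //.
  by apply: filterS uv => t; rewrite ler_norml.
by rewrite -oppr0; exact: cvgN.
Qed.

Lemma cintegral_FTCy F f c l : 0 < c -> ccontinuous f -> cderiv F f ->
  (forall t, 0 <= t -> nrm (f t) <= expR (- (c * t))) ->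
  (nrm (F t - l)) @[t --> +oo] --> (0 : R) ->
  cintegral `[0, +oo[ f = l - F 0.
Proof.
move=> c0 [crf cmf] FD fle Fl; rewrite /cintegral.
have toR (p : R -> R) (L : R) : (forall t, `|p t - L| <= nrm (F t - l)) ->
    p t @[t --> +oo] --> L.
  move=> ple; apply/subr_cvg0; apply: cvg0_dominated Fl.
  by apply: nearW => t; exact: ple.
have rl : Re (F t) @[t --> +oo] --> Re l.
  by apply: toR => t; rewrite -ReN -ReD Re_le_nrm.
have il : Im (F t) @[t --> +oo] --> Im l.
  by apply: toR => t; rewrite -ImN -ImD Im_le_nrm.
rewrite (Rintegral_FTCy c0 crf (fun t => (FD t).1) _ rl); last first.
  by move=> t t0; rewrite (le_trans (Re_le_nrm _))// fle.
rewrite (Rintegral_FTCy c0 cmf (fun t => (FD t).2) _ il); last first.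
  by move=> t t0; rewrite (le_trans (Im_le_nrm _))// fle.
by apply: complex_ext; rewrite !ReImE.
Qed.

(** A rotation makes the increment of f a nonnegative real number; then the real
part of the rotated f minus g is monotone. *)
Lemma cmean_value f df (g dg : R -> R) a b : a <= b ->
  cderiv f df -> (forall t : R, is_derive t (1 : R) g (dg t)) ->
  (forall t, a <= t <= b -> nrm (df t) <= dg t) ->
  nrm (f b - f a) <= g b - g a.
Proof.
move=> ab fD gD fg.
have [u nu uE] : exists2 u : R[i], nrm u = 1 & u * (f b - f a) = (nrm (f b - f a))%:C.
  have [->|f0] := eqVneq (f b - f a) 0.
    by exists 1; rewrite ?nrm1 // nrm0 mulr0.
  exists ((nrm (f b - f a))%:C / (f b - f a)); last by rewrite mulfVK.
  by rewrite nrmM nrmV nrm_real ger0_norm ?nrm_ge0// divff ?nrm_eq0.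
have ufD := cderivZ u fD.
pose h (t : R) := g t - Re (u * f t).
have hD (t : R) : is_derive t (1 : R) h (dg t - Re (u * df t)).
  by have [? _] := ufD t; exact: is_deriveB.
have : h a <= h b.
  have ch : continuous h.
    by move=> t; apply: differentiable_continuous; apply/derivable1_diffP.
  apply: (@ger0_derive1_le_cc _ h a b); rewrite ?in_itv/= ?lexx ?ab //.
  - move=> t; rewrite in_itv /= => /andP[at' tb].
    rewrite derive1E derive_val subr_ge0.
    apply: (@le_trans _ _ (nrm (u * df t))).
      by rewrite (le_trans (ler_norm _))// Re_le_nrm.
    by rewrite nrmM nu mul1r fg// !ltW.
  - exact: continuous_subspaceT.
rewrite /h -[nrm _]/(Re (nrm (f b - f a))%:C) -uE mulrBr !ReImE; lra.
Qed.

End Integral.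

(** * The Gaussian primitive *)

Section ErrorFunction.
Variable R : realType.
Implicit Types (f df : R -> R[i]) (w z : R[i]).
Local Notation mu := (@lebesgue_measure R).

Lemma ccontinuous_bounded f (a : R) : ccontinuous f ->
  exists2 A : R, 0 <= A & \forall t \near a, nrm (f t) <= A.
Proof.
move=> [rf mf]; exists (`|Re (f a)| + `|Im (f a)| + 2).
  by rewrite !addr_ge0.
have := rf a; move=> /cvgrPdist_lt/(_ 1 ltr01).
have := mf a; move=> /cvgrPdist_lt/(_ 1 ltr01).
apply: filterS2 => t h1 h2; rewrite (le_trans (nrm_le_ReIm _))//.
have := ler_distD (Re (f a)) (Re (f t)) 0.
have := ler_distD (Im (f a)) (Im (f t)) 0.
rewrite !subr0 !(distrC (_ (f t))); lra.
Qed.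

Lemma is_derive_Rintegral (F dF : R -> R -> R) (a M : R) :
  (forall t x : R, is_derive t (1 : R) (F ^~ x) (dF t x)) ->
  (forall t, continuous (F t)) ->
  (\forall t \near a, forall x, 0 <= x <= 1 -> `|dF t x| <= M) ->
  is_derive a (1 : R) (fun t => \int[mu]_(x in `[0, 1]) F t x)
    (\int[mu]_(x in `[0, 1]) dF a x).
Proof.
move=> FD cF /nbhs_ballP[e /= e0 dFM].
have M0 : 0 <= M.
  have := dFM a (ballxx _ e0) 0; rewrite lexx ler01 => /(_ isT).
  exact: le_trans.
have dE t x : partial1of2 F t x = dF t x by rewrite partial1of2E derive_val.
have Ia : `]a - e, a + e[%classic a by rewrite /= in_itv/=; lra.
have intF t : mu.-integrable `[0, 1] (EFin \o F t).
  apply: continuous_compact_integrable; first exact: segment_compact.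
  exact: continuous_subspaceT.
have intM : mu.-integrable (`[0, 1]%classic : set R) (EFin \o cst M).
  apply: continuous_compact_integrable; first exact: segment_compact.
  by apply: continuous_subspaceT; exact: cst_continuous.
have bM t x : `]a - e, a + e[%classic t -> `[0, 1]%classic x -> `|partial1of2 F t x| <= M.
  rewrite /= !in_itv /= dE => /andP[h1 h2] hx; apply: dFM => //.
  by rewrite /ball /= ltr_norml; lra.
have dF1 t x : `]a - e, a + e[%classic t -> `[0, 1]%classic x -> derivable (F ^~ x) t 1.
  by move=> _ _; have [] := FD t x.
split.
  by apply: (@derivable_under_integral _ _ _ mu F `[0,
    1] _ _ _ _ Ia _ dF1 _ (fun=> M0) intM bM).
rewrite -derive1E.
rewrite (@differentiation_under_integral _ _ _ mu F `[0,
  1] _ _ _ _ Ia _ dF1 _ (fun=> M0) intM bM) //.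
by apply: eq_Rintegral => x _; rewrite dE.
Qed.

(** This is the integral of exp (- u^2) from 0 to w, parametrised over [0, 1] so
that w can be complex; up to a constant factor it is the error function. *)
Definition gauss_prim (w : R[i]) : R[i] :=
  cintegral `[0, 1] (fun x : R => w * expc (- (w ^+ 2 * (x ^+ 2)%:C))).

(** The derivative of the integrand is the x-derivative of
x exp (- (g t)^2 x^2) times dg t, so that it integrates exactly. *)
Lemma cderiv_gauss_prim (g dg : R -> R[i]) : cderiv g dg -> ccontinuous dg ->
  cderiv (fun t => gauss_prim (g t)) (fun t => expc (- g t ^+ 2) * dg t).
Proof.
move=> gD dgc a.
pose F (t x : R) := g t * expc (- (g t ^+ 2 * (x ^+ 2)%:C)).
pose dF (t x : R) :=
  (1 - 2 * g t ^+ 2 * (x ^+ 2)%:C) * expc (- (g t ^+ 2 * (x ^+ 2)%:C)) * dg t.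
have FD x : cderiv (F ^~ x) (dF ^~ x).
  apply: cderiv_ext; last first.
    apply: (cderivM gD (cderiv_expc (cderivN (cderivM (cderivX 2 gD) (cderiv_cst (x ^+
      2)%:C))))).
  - by move=> t; rewrite /dF /=; ring.
  - by [].
have xD c : cderiv (fun x : R => expc (- (c * (x ^+ 2)%:C)))
    (fun x => expc (- (c * (x ^+ 2)%:C)) * (- (2 * c * x%:C))).
  have := cderiv_expc (cderivN (cderivM (cderiv_cst c) (cderivX 2 (@cderiv_id R)))).
  by apply: cderiv_ext => x /=; rewrite !rmorphXn; [|congr (_ * _); ring].
have cF t : ccontinuous (F t).
  exact: (cderiv_continuous (cderivZ (g t) (xD (g t ^+ 2)))).
have x2D : cderiv (fun x : R => (x ^+ 2)%:C) (fun x => 2 * x%:C).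
  by apply: cderiv_ext (cderivX 2 (@cderiv_id R)) => x /=; rewrite ?rmorphXn //; ring.
have cdF t : ccontinuous (dF t).
  exact: (cderiv_continuous (cderivM (cderivM (cderivB (cderiv_cst 1)
    (cderivZ (2 * g t ^+ 2) x2D)) (xD _)) (cderiv_cst _))).
have intE : cintegral `[0, 1] (dF a) = expc (- g a ^+ 2) * dg a.
  rewrite (@cintegral_FTC _ (fun x => x%:C * (expc (- (g a ^+ 2 * (x ^+ 2)%:C)) * dg a)))
    //.
  - by rewrite expr1n mulr1 mul0r subr0 mul1r.
  - apply: cderiv_ext; last first.
      exact: (cderivM (@cderiv_id R) (cderivM (xD (g a ^+ 2)) (cderiv_cst (dg a)))).
    + by move=> x; rewrite /dF rmorphXn /=; ring.
    + by [].
have [A A0 gA] := ccontinuous_bounded a (cderiv_continuous gD).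
have [B B0 dgB] := ccontinuous_bounded a dgc.
pose M := (1 + 2 * A ^+ 2) * expR (A ^+ 2) * B.
have bnd : \forall t \near a, forall x : R, 0 <= x <= 1 -> nrm (dF t x) <= M.
  apply: filterS2 gA dgB => t tA tB x /andP[x0 x1].
  have x21 : x ^+ 2 <= 1 by rewrite expr_le1.
  have nx : nrm (g t ^+ 2 * (x ^+ 2)%:C) <= A ^+ 2.
    rewrite nrmM nrmX nrm_real ger0_norm ?sqr_ge0// -[leRHS]mulr1.
    by rewrite ler_pM ?exprn_ge0 ?nrm_ge0// lerXn2r ?nnegrE ?nrm_ge0.
  rewrite !nrmM !ler_pM ?mulr_ge0 ?nrm_ge0//.
    rewrite (le_trans (nrmD _ _))// nrm1 lerD2l nrmN -mulrA nrmM.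
    by rewrite (_ : 2 = (2 : R)%:C) ?nrm_real ?ger0_norm ?ler_pM2l// rmorph_nat.
  rewrite nrm_expc ler_expR (le_trans (ler_norm _))// (le_trans (Re_le_nrm _))//.
  by rewrite nrmN.
rewrite -intE; split.
- apply: (@is_derive_Rintegral (fun t x => Re (F t x)) (fun t x => Re (dF t x)) a M).
  + by move=> t x; exact: (FD x t).1.
  + by move=> t; exact: (cF t).1.
  + by apply: filterS bnd => t + x x01 => /(_ x x01); apply: le_trans; exact: Re_le_nrm.
- apply: (@is_derive_Rintegral (fun t x => Im (F t x)) (fun t x => Im (dF t x)) a M).
  + by move=> t x; exact: (FD x t).2.
  + by move=> t; exact: (cF t).2.
  + by apply: filterS bnd => t + x x01 => /(_ x x01); apply: le_trans; exact: Im_le_nrm.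
Qed.

Lemma gauss_prim0 : gauss_prim 0 = 0.
Proof.
rewrite /gauss_prim (@cintegral_FTC _ (fun=> 0)) ?subrr //.
  exact: (cderiv_continuous (cderiv_ext (fun t =>
    esym (mul0r _)) (fun=> erefl) (cderiv_cst 0))).
by apply: cderiv_ext (cderiv_cst 0) => t //; rewrite mul0r.
Qed.

(** The sum of the two sides vanishes at 0 and has derivative 0 along the ray
through w. *)
Lemma gauss_primN w : gauss_prim (- w) = - gauss_prim w.
Proof.
have gD : cderiv (fun t : R => w * t%:C) (fun=> w).
  by apply: cderiv_ext (cderivZ w (@cderiv_id R)) => t //; rewrite mulr1.
have PD : cderiv (fun t : R => gauss_prim (- (w * t%:C)) + gauss_prim (w * t%:C)) (fun=> 0).
  apply: cderiv_ext; last first.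
    apply: cderivD (cderiv_gauss_prim (cderivN gD) _) (cderiv_gauss_prim gD _).
    + exact: (cderiv_continuous (cderiv_cst _)).
    + exact: (cderiv_continuous (cderiv_cst _)).
  - by move=> t /=; rewrite sqrrN; ring.
  - by [].
have := cmean_value (g := fun=> 0) (dg := fun=> 0) ler01 PD (fun t => is_derive_cst _ _ _).
rewrite nrm0 lexx => /(_ (fun _ _ => isT)).
rewrite mulr1 mulr0 oppr0 gauss_prim0 addr0 !subr0 => h.
by apply/eqP; rewrite -addr_eq0 -nrm_eq0 eq_le h nrm_ge0.
Qed.

Lemma gauss_prim_real_cvg :
  nrm (gauss_prim x%:C - (Num.sqrt pi / 2)%:C) @[x --> +oo] --> (0 : R).
Proof.
have rD : cderiv (fun x : R => gauss_prim x%:C) (fun x => (gauss_fun x)%:C).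
  apply: cderiv_ext (cderiv_gauss_prim (@cderiv_id R) (cderiv_continuous (cderiv_cst 1)))
    => x //=.
  by rewrite mulr1 /gauss_fun -rmorphXn -rmorphN expc_real.
have cg : ccontinuous (fun x : R => (gauss_fun x)%:C).
  split; first exact: continuous_gauss_fun.
  exact: cst_continuous.
have PE x : 0 < x -> gauss_prim x%:C = (gauss_integral_proof.integral0_gauss x)%:C.
  move=> x0; rewrite -[LHS]subr0 -gauss_prim0 -(cintegral_FTC x0 cg rD).
  apply: complex_ext => //=.
  by rewrite Rintegral_cst// mul0r.
have gc : @gauss_integral_proof.integral0_gauss R x @[x --> +oo] --> Num.sqrt pi / 2.
  have : Num.sqrt (@gauss_integral_proof.integral0_gauss R x ^+ 2) @[x --> +oo]
      --> Num.sqrt (pi / 4).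
    apply: continuous_cvg; first exact: sqrt_continuous.
    exact: gauss_integral_proof.cvg_integral0_gauss_sqr.
  rewrite sqrtrM ?pi_ge0// sqrtrV// (_ : 4 = 2 ^+ 2); last by rewrite expr2 -natrM.
  rewrite sqrtr_sqr ger0_norm//; apply: cvg_trans.
  apply: near_eq_cvg; apply: nearW => x.
  by rewrite sqrtr_sqr ger0_norm// gauss_integral_proof.integral0_gauss_ge0.
move/subr_cvg0: gc => /cvg_norm; rewrite normr0; apply: cvg_trans.
apply: near_eq_cvg; near=> x; rewrite PE// -rmorphB nrm_real //.
Unshelve. all: by end_near. Qed.

(** Along the segment from a X to (a + i b) X the modulus of exp (- u^2) is at most
exp (- X^2 a^2 (1 - t)), since t^2 <= t; its integral is of order 1 / X even in
the limit case |b| = a, which corresponds to Re z = 0. *)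
Lemma gauss_prim_ray (a b X : R) : 0 < a -> `|b| <= a -> 0 < X ->
  nrm (gauss_prim ((a +i* b) * X%:C) - gauss_prim (a * X)%:C) <= (X * a)^-1.
Proof.
move=> a0 ba X0.
have gD : cderiv (fun t => X%:C * (a%:C + 'i%C * b%:C * t%:C)) (fun=> X%:C * ('i%C * b%:C)).
  apply: cderiv_ext (cderivZ X%:C (cderivD (cderiv_cst a%:C)
    (cderivZ ('i%C * b%:C) (@cderiv_id R)))) => t //.
  by rewrite add0r mulr1.
pose g t := expR (- (X ^+ 2 * a ^+ 2 * (1 - t))) / (X * a).
have gR (t : R) : is_derive t (1 : R) g (X * a * expR (- (X ^+ 2 * a ^+ 2 * (1 - t)))).
  apply: is_derive_eq; rewrite /GRing.scale /=; field.
  by rewrite !gt_eqF.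
have := cmean_value ler01 (cderiv_gauss_prim gD (cderiv_continuous (cderiv_cst _))) gR.
rewrite /g !(mulr0, mulr1, addr0, subr0, subrr, oppr0) expR0 mul1r.
rewrite [X in nrm (gauss_prim X - _)](_ : _ = (a +i* b) * X%:C); last first.
  by rewrite [(a +i* b)%C]complexE /= mulrC.
rewrite -rmorphM [X * a]mulrC.
move=> h; apply: le_trans (h _) _.
  move=> t /andP[t0 t1]; rewrite nrmM nrm_expc !nrmM nrm_i mul1r !nrm_real.
  rewrite [leRHS]mulrC ler_pM ?expR_ge0 ?mulr_ge0//; last first.
    by rewrite (ger0_norm (ltW X0)) [leRHS]mulrC ler_pM2l.
  rewrite ler_expR !expr2 !ReImE /=.
  have b2 : b ^+ 2 <= a ^+ 2 by rewrite -(real_normK (num_real b)) lerXn2r ?nnegrE// ltW.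
  rewrite !(mul0r, mulr0, mul1r, mulr1, subr0, addr0, add0r, sub0r) lerN2.
  rewrite [leRHS](_ : _ = X ^+ 2 * (a ^+ 2 - b ^+ 2 * t ^+ 2)); last by ring.
  rewrite -!expr2 -mulrA ler_pM2l ?exprn_gt0//.
  have : b ^+ 2 * t ^+ 2 <= a ^+ 2 * t.
    by rewrite ler_pM ?sqr_ge0// expr2 ler_piMl.
  by rewrite mulrBr mulr1; lra.
by rewrite lerBlDr lerDl divr_ge0 ?expR_ge0// mulr_ge0 ?ltW.
Qed.

(** The square of x + i u t / x has real part close to x^2 and the bounded imaginary
part 2 u t, so that the Gaussian stays bounded on a segment of length O(1 / x). *)
Lemma gauss_prim_perturb (s : R[i]) (x u : R) : 0 <= Re (s ^+ 2) -> 1 <= x -> `|u| <= 1 ->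
  nrm (gauss_prim (s * (x%:C + 'i%C * (u / x)%:C)) - gauss_prim (s * x%:C)) <=
    nrm s * expR (2 * nrm (s ^+ 2)) / x.
Proof.
move=> s0 x1 u1.
have x0 : 0 < x by exact: lt_le_trans x1.
set C := nrm s * _ / x.
have gD : cderiv (fun t => s * (x%:C + 'i%C * (u / x)%:C * t%:C)) (fun=> s * ('i%C * (u /
  x)%:C)).
  apply: cderiv_ext (cderivZ s (cderivD (cderiv_cst x%:C)
    (cderivZ ('i%C * (u / x)%:C) (@cderiv_id R)))) => t //.
  by rewrite add0r mulr1.
have gR (t : R) : is_derive t (1 : R) (fun t => C * t) C.
  by apply: is_derive_eq; rewrite /GRing.scale /=; ring.
have := cmean_value ler01 (cderiv_gauss_prim gD (cderiv_continuous (cderiv_cst _))) gR.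
rewrite !(mulr0, mulr1, addr0, subr0); apply => t /andP[t0 t1].
rewrite nrmM nrm_expc !nrmM nrm_i mul1r nrm_real mulrC normrM.
rewrite /C -!mulrA ler_wpM2l ?nrm_ge0// mulrA mulrC ler_pM ?mulr_ge0 ?expR_ge0//.
  rewrite ler_expR exprMn.
  rewrite [(x%:C + _) ^+ 2](_ : _ = (x ^+ 2 - (u / x * t) ^+ 2)%:C +
    'i%C * (2 * u * t)%:C); last first.
    apply: complex_ext; rewrite !expr2 !ReImE /=.
      by ring.
    by field; rewrite gt_eqF.
  rewrite mulrDr ReN ReD ReM /= mulr0 subr0.
  rewrite opprD -[leRHS]add0r lerD//.
    rewrite oppr_le0 mulr_ge0// subr_ge0 -(real_normK (num_real (u / x * t))).
    rewrite lerXn2r ?nnegrE ?(ltW x0)//.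
    rewrite !normrM normfV (ger0_norm (ltW x0)) (ger0_norm t0).
    have xi1 : x^-1 <= 1 by rewrite invf_le1.
    rewrite (le_trans _ x1)// -[leRHS]mulr1 ler_pM ?mulr_ge0 ?invr_ge0 ?(ltW x0)//.
    by rewrite -[leRHS]mulr1 ler_pM ?invr_ge0 ?(ltW x0).
  rewrite (le_trans (ler_norm _))// normrN (le_trans (Re_le_nrm _))// !nrmM nrm_i mul1r
    nrm_real.
  rewrite [leLHS]mulrC ler_wpM2r ?mulr_ge0 ?nrm_ge0// !normrM (ger0_norm t0) (ger0_norm
    (ler0n _ 2)).
  by rewrite -mulrA -[leRHS]mulr1 ler_pM2l// -[leRHS]mulr1 ler_pM.
by rewrite normfV (ger0_norm (ltW x0)) ler_piMl// invr_ge0 ltW.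
Qed.

End ErrorFunction.

(** * A primitive of the Schläfli integrand *)

Section Primitive.
Variable R : realType.
Implicit Types (c k z s v : R[i]).
Local Notation ii := ('i%C : R[i]).

(** The tactics [ring] and [field] treat i as an indeterminate; proofs first isolate
a factor i * i and then replace it by - 1. *)
Lemma ii2 : ii * ii = -1. Proof. by rewrite -expr2 sqr_i. Qed.
Lemma ii_neq0 : ii != 0. Proof. by rewrite -nrm_gt0 nrm_i. Qed.
Lemma iiV : ii^-1 = - ii.
Proof. by apply: (mulfI ii_neq0); rewrite divff ?ii_neq0// mulrN ii2 opprK. Qed.

(** This is the generating function of the Bessel functions of integer order,
evaluated at v^2. *)
Definition bessel_gen z v : R[i] := expc (z / 2 * (v ^+ 2 - v^-1 ^+ 2)).

(** When e^2 = 1 and 2 s^2 = z, the exponents add up to z / 2 (v^2 - v^-2), because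
z / 2 y^2 = - (i s y)^2. *)
Definition gauss_wave z s e v : R[i] :=
  expc (e * (ii * z)) * gauss_prim (ii * s * (v - e * ii * v^-1)).

(** For n = 0 and n = 1 the formulas come from
d (v - e i / v) = (1 + e i / v^2) dv; the sum over e = 1, - 1 isolates dv and the
difference isolates v^-2 dv. The step comes from the derivative of
exp (z / 2 (v^2 - v^-2)) v^(-2n-1). *)
Fixpoint schlafli_prim z s n v : R[i] :=
  match n with
  | 0 => (gauss_wave z s 1 v + gauss_wave z s (-1) v) / (2 * ii * s)
  | 1 => (gauss_wave z s 1 v - gauss_wave z s (-1) v) / (- (2 * s))
  | (n1.+1 as n2).+1 =>
    (bessel_gen z v * v^-1 ^+ (n1.*2.+1) + (n1.*2.+1)%:R * schlafli_prim z s n2 v) / z -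
      schlafli_prim z s n1 v
  end.

Lemma schlafli_primSS z s n v : schlafli_prim z s n.+2 v =
  (bessel_gen z v * v^-1 ^+ (n.*2.+1) + (n.*2.+1)%:R * schlafli_prim z s n.+1 v) / z -
    schlafli_prim z s n v.
Proof. by []. Qed.

Lemma schlafli_primN z s n v : schlafli_prim z s n (- v) = - schlafli_prim z s n v.
Proof.
have gauss_waveN e : gauss_wave z s e (- v) = - gauss_wave z s e v.
  rewrite /gauss_wave [X in gauss_prim X](_ : _ = - (ii * s * (v - e * ii * v^-1))).
    by rewrite gauss_primN mulrN.
  by rewrite invrN; ring.
elim/ltn_ind: n => -[|[|n]] IH.
- by rewrite /= !gauss_waveN; ring.
- by rewrite /= !gauss_waveN; ring.
rewrite !schlafli_primSS !IH // /bessel_gen !invrN !sqrrN exprNn -signr_odd oddS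
  odd_double expr1; ring.
Qed.

Section Curve.
Variables (c k : R[i]).
Hypothesis c0 : c != 0.
Let V (t : R) := c * expc (k * t%:C).

Lemma curve_neq0 t : V t != 0.
Proof. by rewrite mulf_neq0// expc_neq0. Qed.

Lemma cderiv_curve : cderiv V (fun t => k * V t).
Proof.
apply: cderiv_ext (cderivZ c (cderiv_expc (cderivZ k (@cderiv_id R)))) => t //.
by rewrite /V; ring.
Qed.

Lemma cderiv_curveV : cderiv (fun t => (V t)^-1) (fun t => - k * (V t)^-1).
Proof.
apply: cderiv_ext (cderivZ c^-1 (cderiv_expc (cderivZ (- k) (@cderiv_id R)))) => t.
  by rewrite mulNr expcN /V invfM mulrC.
by rewrite mulNr expcN /V invfM; ring.
Qed.

Lemma cderiv_bessel_gen z : cderiv (fun t => bessel_gen z (V t))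
  (fun t => bessel_gen z (V t) * (z * k * (V t ^+ 2 + (V t)^-1 ^+ 2))).
Proof.
have := cderiv_expc (cderivZ (z / 2)
  (cderivB (cderivX 2 cderiv_curve) (cderivX 2 cderiv_curveV))).
apply: cderiv_ext => t; first by [].
by congr (_ * _); rewrite /= !expr1; field; exact: curve_neq0.
Qed.

Lemma cderiv_gauss_wave z s e : 2 * s ^+ 2 = z -> e ^+ 2 = 1 ->
  cderiv (fun t => gauss_wave z s e (V t))
    (fun t => bessel_gen z (V t) * (ii * s * k * (V t + e * ii * (V t)^-1))).
Proof.
move=> sz e2.
have D := cderivZ (ii * s) (cderivB cderiv_curve (cderivZ (e * ii) cderiv_curveV)).
have D' : ccontinuous (fun t => ii * s * (k * V t - e * ii * (- k * (V t)^-1))).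
  exact: (cderiv_continuous (cderivZ (ii * s) (cderivB (cderivZ k cderiv_curve)
    (cderivZ (e * ii) (cderivZ (- k) cderiv_curveV))))).
apply: cderiv_ext (cderivZ (expc (e * (ii * z))) (cderiv_gauss_prim D D')) => t //.
rewrite /bessel_gen mulrA -expcD; congr (expc _ * _); last by ring.
have Vn0 := curve_neq0 t.
have -> : - (ii * s * (V t - e * ii / V t)) ^+ 2 =
    - (ii * ii) * s ^+ 2 * (V t ^+ 2 - 2 * e * ii + e ^+ 2 * (ii * ii) * (V t)^-1 ^+ 2).
  by field.
by rewrite ii2 e2 -sz; field; exact: Vn0.
Qed.

Lemma cderiv_schlafli_prim z s n : z != 0 -> 2 * s ^+ 2 = z ->
  cderiv (fun t => schlafli_prim z s n (V t))
    (fun t => k * (bessel_gen z (V t) * (V t)^-1 ^+ n.*2 * V t)).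
Proof.
move=> z0 sz.
have s0 : s != 0 by apply: contra_neq z0 => s0; rewrite -sz s0 expr0n mulr0.
have P1 := cderiv_gauss_wave sz (expr1n _ 2).
have P2 : cderiv _ _ := cderiv_gauss_wave sz (etrans (sqrrN 1) (expr1n _ 2)).
have ii0 := ii_neq0.
elim/ltn_ind: n => -[|[|n]] IH.
- apply: cderiv_ext (cderivM (cderivD P1 P2) (cderiv_cst (2 * ii * s)^-1)) => t //=.
  by rewrite expr0; field; rewrite ?ii0 ?s0 ?curve_neq0.
- apply: cderiv_ext (cderivM (cderivB P1 P2) (cderiv_cst (- (2 * s))^-1)) => t //=.
  have Vn0 := curve_neq0 t.
  rewrite mulr0 addr0 [LHS](_ : _ = - (ii * ii) * k * bessel_gen z (V t) / V t).
    by rewrite ii2; field.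
  by field; rewrite s0 Vn0.
have D := cderivB (cderivM (cderivD (cderivM (cderiv_bessel_gen z) (cderivX n.*2.+1
  cderiv_curveV))
  (cderivZ (n.*2.+1)%:R (IH n.+1 (ltnSn _)))) (cderiv_cst z^-1)) (IH n (leqnSn _)).
apply: cderiv_ext D => t //.
have Vn0 := curve_neq0 t.
rewrite !doubleS !exprS /= -natr1.
set q := (V t)^-1 ^+ n.*2.
by field; rewrite z0 Vn0.
Qed.

End Curve.
End Primitive.

(** * Behaviour of the primitive at infinity *)

Section Limit.
Variable R : realType.
Implicit Types (z s l : R[i]) (f g : R -> R[i]).
Local Notation ii := ('i%C : R[i]).

(** Convergence is expressed by a real modulus, which makes real domination arguments
applicable. *)
Definition cvgcy f l := nrm (f t - l) @[t --> +oo] --> (0 : R).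

Lemma cvgcy_le f l (g : R -> R) : (\forall t \near +oo, nrm (f t - l) <= g t) ->
  g t @[t --> +oo] --> (0 : R) -> cvgcy f l.
Proof.
move=> fg; apply: cvg0_dominated; apply: filterS fg => t.
by rewrite ger0_norm ?nrm_ge0.
Qed.

Lemma cvgcy_eq f g l l' : f =1 g -> l = l' -> cvgcy f l -> cvgcy g l'.
Proof. by move=> /funext -> ->. Qed.

Lemma cvgcyD f g l l' : cvgcy f l -> cvgcy g l' -> cvgcy (fun t => f t + g t) (l + l').
Proof.
move=> fl gl; apply: (@cvgcy_le _ _ (fun t => nrm (f t - l) + nrm (g t - l'))).
  by apply: nearW => t; rewrite opprD addrACA nrmD.
by rewrite -[0]addr0; exact: cvgD.
Qed.

Lemma cvgcyZ c f l : cvgcy f l -> cvgcy (fun t => c * f t) (c * l).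
Proof.
move=> fl; apply: (@cvgcy_le _ _ (fun t => nrm c * nrm (f t - l))).
  by apply: nearW => t; rewrite -mulrBr nrmM.
by rewrite -[0](mulr0 (nrm c)); apply: cvgM => //; exact: cvg_cst.
Qed.

Lemma cvgcyB f g l l' : cvgcy f l -> cvgcy g l' -> cvgcy (fun t => f t - g t) (l - l').
Proof.
move=> fl /(cvgcyZ (-1)) gl; have := cvgcyD fl gl; rewrite /cvgcy mulN1r.
by under eq_fun do rewrite mulN1r.
Qed.

Lemma cvg_exp_halfV : (expR (t / 2))^-1 @[t --> +oo] --> (0 : R).
Proof.
under eq_fun do rewrite -expRN.
apply: (@cvg_comp _ _ _ (fun t : R => t / 2) (fun t => expR (- t))); last exact: cvgr_expR.
by apply: gt0_cvgMly => //; exact: cvg_id.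
Qed.

Lemma cvg_exp_half : expR (t / 2 : R) @[t --> +oo] --> +oo.
Proof.
apply/gtr0_cvgV0; last exact: cvg_exp_halfV.
by apply: nearW => t; exact: expR_gt0.
Qed.

Lemma exp_half_ge1 : \forall t \near +oo, 1 <= expR (t / 2 : R).
Proof.
near=> t; rewrite -expR0 ler_expR divr_ge0//.
Unshelve. all: by end_near. Qed.

(** The function of index n is sqrt (2 pi z) J_(n - 1/2) (z); the step is
J_(nu+1) = (2 nu / z) J_nu - J_(nu-1) with nu = n + 1/2. *)
Fixpoint hbessel z n : R[i] :=
  match n with
  | 0 => expc (ii * z) + expc (- (ii * z))
  | 1 => (expc (ii * z) - expc (- (ii * z))) / ii
  | (n1.+1 as n2).+1 => (n1.*2.+1)%:R / z * hbessel z n2 - hbessel z n1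
  end.

Lemma hbesselSS z n : hbessel z n.+2 = (n.*2.+1)%:R / z * hbessel z n.+1 - hbessel z n.
Proof. by []. Qed.

Section RightHalfPlane.
Variables z s : R[i].
Hypotheses (z0 : z != 0) (Rez : 0 <= Re z) (sz : 2 * s ^+ 2 = z) (Res : 0 < Re s).

Let Res2 : 0 <= Re (s ^+ 2).
Proof.
have : Re z = 2 * Re (s ^+ 2) by rewrite -sz !ReImE /=; ring.
by move=> e; move: Rez; rewrite e pmulr_rge0.
Qed.

Let Ims : `|Im s| <= Re s.
Proof.
rewrite -[leRHS]ger0_norm ?(ltW Res)// -sqrtr_sqr -[leRHS]sqrtr_sqr ler_wsqrtr//.
by move: Res2; rewrite expr2 ReM -!expr2 subr_ge0.
Qed.

(** The rays with 0 < Re s and |Im s| <= Re s are those on which exp (- (s x)^2) is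
bounded: rotate to the real axis, where the limit is the Gaussian integral. *)
Lemma gauss_prim_cvg (u : R) : `|u| <= 1 ->
  cvgcy (fun t => gauss_prim (s * ((expR (t / 2))%:C + ii * (u / expR (t / 2))%:C)))
    (Num.sqrt pi / 2)%:C.
Proof.
move=> u1; set l := (_ / 2)%:C.
pose C1 := nrm s * expR (2 * nrm (s ^+ 2)).
pose x (t : R) := expR (t / 2).
apply: (@cvgcy_le _ _ (fun t => (C1 + (Re s)^-1) * (x t)^-1 +
  nrm (gauss_prim (Re s * x t)%:C - l))).
  apply: filterS exp_half_ge1 => t x1; rewrite -/(x t).
  have x0 : 0 < x t by exact: expR_gt0.
  have := gauss_prim_perturb Res2 x1 u1; have := gauss_prim_ray Res Ims x0.
  have -> : Re s +i* Im s = s by case: (s).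
  rewrite -/C1 invfM => h2 h1.
  rewrite mulrDl.
  have := nrmD (gauss_prim (s * ((x t)%:C + ii * (u / x t)%:C)) - gauss_prim (s * (x t)%:C))
    ((gauss_prim (s * (x t)%:C) - gauss_prim (Re s * x t)%:C) +
      (gauss_prim (Re s * x t)%:C - l)).
  have := nrmD (gauss_prim (s * (x t)%:C) - gauss_prim (Re s * x t)%:C) (gauss_prim (Re s
    * x t)%:C - l).
  rewrite !addrA !subrK => h3 h4.
  apply: le_trans h4 _; rewrite -addrA lerD// (le_trans h3)// lerD//.
  by rewrite [leRHS]mulrC.
rewrite -[0]addr0; apply: cvgD.
  rewrite -[0](mulr0 (C1 + (Re s)^-1)); apply: cvgM; first exact: cvg_cst.
  exact: cvg_exp_halfV.
apply: (@cvg_comp _ _ _ (fun t => Re s * x t) (fun y : R => nrm (gauss_prim y%:C - l))).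
  2: exact: gauss_prim_real_cvg.
apply: gt0_cvgMry => //; exact: cvg_exp_half.
Qed.

Lemma gauss_wave_cvg (u : R) : `|u| <= 1 ->
  cvgcy (fun t => gauss_wave z s u%:C (ii * expc ((2^-1)%:C * t%:C)))
    (- expc (u%:C * (ii * z)) * (Num.sqrt pi / 2)%:C).
Proof.
move=> u1; apply: cvgcy_eq (cvgcyZ (- expc (u%:C * (ii * z))) (gauss_prim_cvg u1)) => // t.
rewrite mulNr -mulrN -gauss_primN /gauss_wave; congr (_ * gauss_prim _).
rewrite -rmorphM expc_real [2^-1 * t]mulrC invfM iiV rmorphM fmorphV.
set x := (expR _)%:C.
rewrite (_ : - (s * _) = (ii * ii) * s * (x + ii * (u%:C / x))); last by rewrite ii2; ring.
by ring.
Qed.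

(** The two Gaussian factors tend to the same constant, so that exponentials of
i z and - i z remain; the integrated term of the recurrence vanishes at infinity. *)
Lemma schlafli_prim_cvg n :
  cvgcy (fun t => schlafli_prim z s n (ii * expc ((2^-1)%:C * t%:C)))
    (- (Num.sqrt pi)%:C / (4 * ii * s) * hbessel z n).
Proof.
have s0 : s != 0 by apply: contraTneq Res => ->; rewrite ltxx.
have P2 := @gauss_wave_cvg (-1).
have P1 := @gauss_wave_cvg 1.
rewrite normrN normr1 lexx in P1 P2; have {}P1 := P1 isT; have {}P2 := P2 isT.
set q := (Num.sqrt pi)%:C; have qE : (Num.sqrt pi / 2)%:C = q / 2.
  by rewrite rmorphM fmorphV rmorph_nat.
have e1 : (-1)%:C = -1 :> R[i] by rewrite rmorphN rmorph1.
rewrite qE ?e1 ?rmorph1 in P1 P2.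
have ii0 := @ii_neq0 R.
elim/ltn_ind: n => -[|[|n]] IH.
- apply: cvgcy_eq (cvgcyZ (2 * ii * s)^-1 (cvgcyD P1 P2)) => [t|]; first by rewrite mulrC.
  by rewrite mul1r mulN1r /=; field; rewrite s0 ii0.
- apply: cvgcy_eq (cvgcyZ (- (2 * s))^-1 (cvgcyB P1 P2)) => [t|]; first by rewrite mulrC.
  rewrite mul1r mulN1r.
  rewrite [RHS](_ : _ = (- (ii * ii))^-1 * (q / (4 * s) * (expc (ii * z) -
    expc (- (ii * z))))).
    by rewrite ii2; field.
  by rewrite /=; field; rewrite s0 ii0.
set V := fun t : R => ii * expc ((2^-1)%:C * t%:C).
have g0 : cvgcy (fun t => bessel_gen z (V t) * (V t)^-1 ^+ n.*2.+1) 0.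
  apply: (cvgcy_le _ cvg_exp_halfV); apply: filterS exp_half_ge1 => t x1.
  have VE : V t = ii * (expR (t / 2))%:C by rewrite /V -rmorphM expc_real [2^-1 * t]mulrC.
  rewrite subr0 VE; set x := expR _ in x1 *.
  have x0 : 0 < x by exact: lt_le_trans x1.
  rewrite nrmM -[leRHS]mul1r ler_pM ?nrm_ge0//.
    rewrite /bessel_gen nrm_expc -[leRHS]expR0 ler_expR.
    rewrite [X in Re X](_ : _ = ii * ii * ((x ^+ 2 - x^-1 ^+ 2) / 2)%:C * z).
      rewrite ii2 mulN1r ReM ReN ImN /= oppr0 mul0r subr0 mulNr oppr_le0.
      rewrite mulr_ge0// divr_ge0// subr_ge0 lerXn2r ?nnegrE ?invr_ge0 ?(ltW x0)//.
      by rewrite (le_trans _ x1)// invf_le1.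
    by rewrite invfM iiV !rmorphM rmorphB !rmorphXn !fmorphV rmorph_nat; ring.
  rewrite nrmX nrmV nrmM nrm_i mul1r nrm_real ger0_norm ?(ltW x0)//.
  by rewrite exprS ler_piMr ?invr_ge0 ?(ltW x0)// exprn_ile1 ?invr_ge0 ?(ltW x0)// invf_le1.
have := cvgcyB (cvgcyZ z^-1 (cvgcyD g0 (cvgcyZ (n.*2.+1)%:R (IH n.+1 (ltnSn _))))) (IH n
  (leqnSn _)).
apply: cvgcy_eq => [t|]; first by rewrite schlafli_primSS [z^-1 * _]mulrC.
by rewrite hbesselSS; field; rewrite ii0 s0 z0.
Qed.

End RightHalfPlane.
End Limit.

(** * Evaluation of the integral formula *)

Section Schlafli.
Variable R : realType.
Implicit Types (k z s : R[i]).
Local Notation ii := ('i%C : R[i]).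

Lemma expc_sin (t : R) : expc (ii * t%:C) - expc (- (ii * t%:C)) = 2 * ii * (sin t)%:C.
Proof.
rewrite /expc !ReImE /= !(mul0r, mul1r, mulr0, subr0, add0r, oppr0) expR0 cosN sinN.
by apply: complex_ext; rewrite !ReImE /=; ring.
Qed.

Lemma bessel_gen_exp z k (t : R) n :
  bessel_gen z (1 * expc (k * t%:C)) * (1 * expc (k * t%:C))^-1 ^+ n.+1.*2 *
    (1 * expc (k * t%:C)) =
  expc (z / 2 * (expc (2 * (k * t%:C)) - expc (- (2 * (k * t%:C)))) - k * t%:C *+ n.*2.+1).
Proof.
rewrite mul1r /bessel_gen; set E := expc (k * _).
have E0 : E != 0 by exact: expc_neq0.
have E2 : expc (2 * (k * t%:C)) = E ^+ 2 by rewrite -expcMn mulr_natl.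
rewrite [expc (- (2 * _))]expcN E2 expcD expcN expcMn -/E -!exprVn -mulrA; congr (_ * _).
by rewrite doubleS exprSr -mulrA mulVf// mulr1.
Qed.

(** The cosine is half the sum of two exponentials, each of which is the form pulled
back to one of the arcs exp (i t / 2) and exp (- i t / 2); the arcs start at 1 and
end at i and - i, where the primitive takes opposite values. *)
Lemma schlafli_arc m z s : z != 0 -> 2 * s ^+ 2 = z ->
  cintegral `[0, pi] (fun t => cosc (((m%:R + 2^-1) * t)%:C - z * (sin t)%:C)) =
  - (2 * ii) * schlafli_prim z s m.+1 ii.
Proof.
move=> z0 sz.
have D1 := cderiv_schlafli_prim (ii / 2) (oner_neq0 _) m.+1 z0 sz.
have D2 := cderiv_schlafli_prim (- (ii / 2)) (oner_neq0 _) m.+1 z0 sz.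
have wE (t : R) : cosc (((m%:R + 2^-1) * t)%:C - z * (sin t)%:C) =
    - ii * (ii / 2 * (bessel_gen z (1 * expc (ii / 2 * t%:C)) *
       (1 * expc (ii / 2 * t%:C))^-1 ^+ m.+1.*2 * (1 * expc (ii / 2 * t%:C))) -
    - (ii / 2) * (bessel_gen z (1 * expc (- (ii / 2) * t%:C)) *
       (1 * expc (- (ii / 2) * t%:C))^-1 ^+ m.+1.*2 * (1 * expc (- (ii / 2) * t%:C)))).
  rewrite !bessel_gen_exp.
  have -> : 2 * (ii / 2 * t%:C) = ii * t%:C by field.
  have -> : 2 * (- (ii / 2) * t%:C) = - (ii * t%:C) by field.
  rewrite opprK expc_sin -[expc (- (ii * t%:C)) - _]opprB expc_sin.
  have avg (a b : R[i]) : - ii * (ii / 2 * a - - (ii / 2) * b) = (a + b) / 2.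
    rewrite [LHS](_ : _ = - (ii * ii) * (a + b) / 2); last by field.
    by rewrite ii2 opprK mul1r.
  have tE : ((m%:R + 2^-1) * t)%:C = (m.*2.+1)%:R / 2 * t%:C.
    by rewrite rmorphM rmorphD fmorphV !rmorph_nat -[(m.*2.+1)%:R]natr1 -muln2 natrM; field.
  rewrite avg /cosc addrC tE; congr ((expc _ + expc _) / 2).
    by rewrite -[in RHS]mulr_natr; field.
  by rewrite -[in RHS]mulr_natr; field.
have FD := cderivZ (- ii) (cderivB D1 D2).
under [X in cintegral _ X]eq_fun do rewrite wE.
rewrite (cintegral_FTC _ _ FD); [|exact: pi_gt0|].
  rewrite rmorph0 !mulr0 expc0 subrr mulr0 subr0 !mul1r.
  have -> : ii / 2 * pi%:C = ii * (pi / 2)%:C by rewrite rmorphM fmorphV rmorph_nat; ring.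
  have -> : - (ii / 2) * pi%:C = - (ii * (pi / 2)%:C) by rewrite rmorphM fmorphV
    rmorph_nat; ring.
  by rewrite expcN expc_ipi2 iiV schlafli_primN; ring.
have S k := cderivM (cderivM (cderiv_bessel_gen k (oner_neq0 _) z)
  (cderivX m.+1.*2 (cderiv_curveV 1 k))) (cderiv_curve 1 k).
exact: (cderiv_continuous (cderivZ (- ii) (cderivB (cderivZ (ii / 2) (S _))
  (cderivZ (- (ii / 2)) (S _))))).
Qed.

(** On v = i exp (t / 2) one has (v^2 - v^-2) / 2 = - sinh t. *)
Lemma schlafli_ray m z s : z != 0 -> 0 <= Re z -> 2 * s ^+ 2 = z -> 0 < Re s ->
  cintegral `[0, +oo[ (fun t => expc (- (z * (sinhr t)%:C) - ((m%:R + 2^-1) * t)%:C)) =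
  2 * ii ^+ m.*2.+1 * (- (Num.sqrt pi)%:C / (4 * ii * s) * hbessel z m.+1 -
    schlafli_prim z s m.+1 ii).
Proof.
move=> z0 Rez sz Res.
have ii0 := @ii_neq0 R.
have D := cderivZ (2 * ii ^+ m.*2.+1) (cderiv_schlafli_prim (2^-1)%:C ii0 m.+1 z0 sz).
have fE (t : R) : expc (- (z * (sinhr t)%:C) - ((m%:R + 2^-1) * t)%:C) =
  2 * ii ^+ m.*2.+1 * ((2^-1)%:C * (bessel_gen z (ii * expc ((2^-1)%:C * t%:C)) *
   (ii * expc ((2^-1)%:C * t%:C))^-1 ^+ m.+1.*2 * (ii * expc ((2^-1)%:C * t%:C)))).
  set E := expc (_ * t%:C); have E0 : E != 0 by exact: expc_neq0.
  have V0 : ii * E != 0 by rewrite mulf_neq0.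
  have E2 : E ^+ 2 = (expR t)%:C.
    rewrite -expcMn -expc_real; congr expc.
    by rewrite fmorphV rmorph_nat; field.
  have VV : (ii * E)^-1 ^+ m.+1.*2 * (ii * E) = ((ii * E) ^+ m.*2.+1)^-1.
    by rewrite doubleS exprSr mulfVK// exprVn.
  rewrite -[bessel_gen _ _ * _ * _]mulrA VV.
  rewrite [X in _ = X](_ : _ = bessel_gen z (ii * E) * (ii ^+ m.*2.+1 / (ii * E) ^+
    m.*2.+1)); last first.
    by rewrite fmorphV rmorph_nat; field; rewrite expf_neq0.
  rewrite exprMn invfM mulVKf ?expf_neq0// -expcMn -expcN /bessel_gen -expcD; congr expc.
  rewrite invfM iiV !exprMn sqrrN expr2 ii2 exprVn E2 /sinhr expRN.
  rewrite !(rmorphM, rmorphD, rmorphN, fmorphV,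
    rmorph_nat) -[(2^-1 * _) *+ _]mulr_natr -[(m.*2.+1)%:R]natr1 -muln2 natrM.
  field.
  by rewrite -(rmorph0 (real_complex R)) (inj_eq (@complexI R)) gt_eqF ?expR_gt0.
under [X in cintegral _ X]eq_fun do rewrite fE.
have L := cvgcyZ (2 * ii ^+ m.*2.+1) (schlafli_prim_cvg z0 Rez sz Res m.+1).
rewrite (@cintegral_FTCy _ _ _ 2^-1 _ _ _ D _ L) //.
- by rewrite rmorph0 mulr0 expc0 mulr1 mulrBr.
- have S := cderivM (cderivM (cderiv_bessel_gen (2^-1)%:C ii0 z)
    (cderivX m.+1.*2 (cderiv_curveV ii (2^-1)%:C))) (cderiv_curve ii (2^-1)%:C).
  exact: (cderiv_continuous (cderivZ (2 * ii ^+ m.*2.+1) (cderivZ (2^-1)%:C S))).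
move=> t t0; rewrite -fE nrm_expc ler_expR !ReImE /= mulr0 subr0.
have sh : 0 <= sinhr t by rewrite /sinhr divr_ge0// subr_ge0 ler_expR; lra.
rewrite -[leRHS]add0r lerD //; first by rewrite oppr_le0 mulr_ge0.
by rewrite lerN2 ler_wpM2r// lerDr ler0n.
Qed.

(** The values of the primitive at v = i cancel, because
(- 1)^(m+1) i^(2m+1) = - i. *)
Lemma schlafli_hbessel m z : z != 0 -> 0 <= Re z ->
  schlafli m z = ((Num.sqrt (2 * pi))^-1)%:C * (hbessel z m.+1 / sqrtc z).
Proof.
move=> z0 Rez; set q := sqrtc z.
have q0 : q != 0 by rewrite sqrtc_eq0.
pose r2 := (Num.sqrt 2 : R)%:C.
have r20 : Num.sqrt 2 != 0 :> R by rewrite gt_eqF// sqrtr_gt0.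
have r2n0 : r2 != 0 by rewrite -(rmorph0 (real_complex R)) (inj_eq (@complexI R)).
have r22 : r2 ^+ 2 = 2 by rewrite -rmorphXn sqr_sqrtr// rmorph_nat.
(* This s satisfies 2 s^2 = z and |arg s| <= pi / 4. *)
pose s := q / r2.
have sz : 2 * s ^+ 2 = z by rewrite expr_div_n r22 sqr_sqrtc mulrC divfK// pnatr_eq0.
have Req : 0 < Re q.
  rewrite /q; move: z0 Rez; rewrite -nrm_gt0; case: (z) => a b /= n0 a0.
  by rewrite sqrtr_gt0 divr_gt0// ltr_wpDr.
have Res : 0 < Re s.
  by rewrite /s -fmorphV mulrC ReM /= mul0r subr0 mulr_gt0// invr_gt0 lt_def r20 sqrtr_ge0.
rewrite /schlafli (schlafli_arc m z0 sz) (schlafli_ray m z0 Rez sz Res).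
have w0 : Num.sqrt pi != 0 :> R by rewrite gt_eqF// sqrtr_gt0 pi_gt0.
set p := schlafli_prim _ _ _ _; set Y := hbessel _ _.
have -> : pi^-1 = (Num.sqrt pi)^-1 ^+ 2 :> R by rewrite exprVn sqr_sqrtr// pi_ge0.
rewrite sqrtrM// rmorphXn !fmorphV rmorphM -/r2 /s.
set w := (Num.sqrt pi)%:C.
have wn0 : w != 0 by rewrite -(rmorph0 (real_complex R)) (inj_eq (@complexI R)).
have iE : (-1) ^+ m.+1 * ii ^+ m.*2.+1 = - ii.
  rewrite exprS -mul2n exprS exprM sqr_i mulrCA mulrA [X in X = _](_ : _ = -
    ((-1) ^+ m * (-1) ^+ m) * ii).
    by rewrite -exprMn mulrNN mulr1 expr1n mulN1r.
  by ring.
rewrite [X in _ + X](_ : _ = (-1) ^+ m.+1 * ii ^+ m.*2.+1 * (2 * w^-1 ^+ 2 * (- w / (4 *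
  ii * (q / r2)) * Y - p))).
  rewrite iE; have ii0 := @ii_neq0 R.
  rewrite [RHS](_ : _ = r2 / r2 ^+ 2 / w * (Y / q)); last by field; rewrite ?r2n0 ?q0 ?wn0.
  by rewrite r22; field; rewrite ?r2n0 ?q0 ?wn0 ?ii0.
by ring.
Qed.

End Schlafli.

(** * The coefficients *)

Section Coefficients.
Local Open Scope nat_scope.

(** The double factorial (2n - 1)!!. *)
Definition odd_prod n := \prod_(0 <= j < n) (j.*2.+1).

Lemma odd_prodS n : odd_prod n.+1 = odd_prod n * n.*2.+1.
Proof. by rewrite /odd_prod big_nat_recr. Qed.

Lemma odd_prod_gt0 n : 0 < odd_prod n.
Proof. by apply: prodn_gt0. Qed.

Lemma fact_double n : (n.*2)`! = odd_prod n * (2 ^ n * n`!).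
Proof.
elim: n => [|n IH]; first by rewrite /odd_prod big_nil.
rewrite doubleS !factS IH odd_prodS expnS -mul2n; nia.
Qed.

Lemma fact_doubleS n : (n.*2.+1)`! = odd_prod n.+1 * (2 ^ n * n`!).
Proof. by rewrite factS fact_double odd_prodS; nia. Qed.

(** This is (m + k)! / (k! (m - k)! 2^k), written as an integer that vanishes for
k > m. *)
Definition bessel_poly_coef m k := 'C(m + k, k.*2) * odd_prod k.

Lemma bessel_poly_coef0 m : bessel_poly_coef m 0 = 1.
Proof. by rewrite /bessel_poly_coef bin0 /odd_prod big_nil. Qed.

Lemma bessel_poly_coef_small m k : m < k -> bessel_poly_coef m k = 0.
Proof. by move=> mk; rewrite /bessel_poly_coef bin_small// -addnn ltn_add2r. Qed.

(** By Pascal's rule and (2k+1) C(N, 2k+1) = (N - 2k) C(N, 2k), with N = m + k + 1. *)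
Lemma bessel_poly_coef_rec m k :
  bessel_poly_coef m.+2 k.+1 = m.*2.+3 * bessel_poly_coef m.+1 k + bessel_poly_coef m k.+1.
Proof.
rewrite /bessel_poly_coef odd_prodS addSn addnS !addSn doubleS addnS.
have [N NE] : exists N, N = (m + k).+1 by eexists.
rewrite -NE !binS.
have E : k.*2.+1 * 'C(N, k.*2.+1) = (N - k.*2) * 'C(N, k.*2) by exact: mul_bin_left.
have [le|lt] := leqP k.*2 N; last first.
  have b0 j : k.*2 <= j -> 'C(N, j) = 0 by move=> kj; rewrite bin_small//; lia.
  by rewrite !b0 //; lia.
have aE : N - k.*2 + k.*2 = N by rewrite subnK.
have mE : m.*2.+3 = 2 * (N - k.*2) + k.*2.+1 by lia.
rewrite mE; move: (f_equal (muln (2 * odd_prod k)) E).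
move: ('C(N, k.*2.+2)) ('C(N, k.*2.+1)) ('C(N, k.*2)) (N - k.*2) (k.*2.+1) (odd_prod k).
by clear => x y w a b d E; lia.
Qed.

(** Each of (2d + 2k + 1)!, (2d + 1)! and (2k)! is a product of odd numbers times a
power of 2 and a factorial; the powers of 2 cancel. *)
Lemma bin_odd_prod_odd d k :
  'C(d + k, k) * odd_prod (d + k).+1 = bessel_poly_coef (d.*2 + k).+1 k * odd_prod d.+1.
Proof.
have h1 : 'C(d + k, k) * (k`! * d`!) = (d + k)`!.
  by rewrite -(bin_fact (leq_addl d k)) addnK.
have h2 : 'C((d + k).*2.+1, k.*2) * ((k.*2)`! * (d.*2.+1)`!) = ((d + k).*2.+1)`!.
  rewrite -(@bin_fact (d + k).*2.+1 k.*2); last by lia.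
  by congr (_ * (_ * _`!)); lia.
have -> : bessel_poly_coef (d.*2 + k).+1 k = 'C((d + k).*2.+1, k.*2) * odd_prod k.
  by rewrite /bessel_poly_coef; congr ('C(_, _) * _); lia.
move: h2; rewrite fact_double !fact_doubleS -h1 expnD => h2.
apply/eqP; rewrite -(@eqn_pmul2r (2 ^ d * 2 ^ k * (k`! * d`!))).
  by apply/eqP; move: h2; lia.
by rewrite !muln_gt0 !expn_gt0 !fact_gt0.
Qed.

Lemma bin_odd_prod_even e k :
  'C(e + k, k) * odd_prod (e + k) = bessel_poly_coef (e.*2 + k) k * odd_prod e.
Proof.
have h1 : 'C(e + k, k) * (k`! * e`!) = (e + k)`!.
  by rewrite -(bin_fact (leq_addl e k)) addnK.
have h2 : 'C((e + k).*2, k.*2) * ((k.*2)`! * (e.*2)`!) = ((e + k).*2)`!.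
  rewrite -(@bin_fact (e + k).*2 k.*2); last by lia.
  by congr (_ * (_ * _`!)); lia.
have -> : bessel_poly_coef (e.*2 + k) k = 'C((e + k).*2, k.*2) * odd_prod k.
  by rewrite /bessel_poly_coef; congr ('C(_, _) * _); lia.
move: h2; rewrite !fact_double -h1 expnD => h2.
apply/eqP; rewrite -(@eqn_pmul2r (2 ^ e * 2 ^ k * (k`! * e`!))).
  by apply/eqP; move: h2; lia.
by rewrite !muln_gt0 !expn_gt0 !fact_gt0.
Qed.

(** The reversal k -> s + t - k turns the factors into the odd numbers 2k + 1. *)
Lemma Rprod_odd_prod s t : s <= t.+1 ->
  (Rprod s t (s + t) * (odd_prod s)%:Z = (odd_prod t.+1)%:Z)%R.
Proof.
move=> st; rewrite /Rprod big_nat_rev /= mulrC.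
rewrite [X in (_ * X)%R](_ : _ = (\prod_(s <= j < t.+1) j.*2.+1)%N%:Z)%R.
  by rewrite -PoszM /odd_prod [in RHS](@big_cat_nat _ _ _ s).
rewrite (big_morph Posz PoszM erefl).
by apply: eq_big_nat => i /andP[si it]; lia.
Qed.

(** When m - k is odd, the product and the binomial coefficient compare directly.
When it is even, the two binomial coefficients of beta first combine into one, by
the absorption identities. *)
Lemma beta_coefE m k : k <= m ->
  (beta_coef m k.+1 = (-1) ^+ (m + k) * (bessel_poly_coef m k)%:Z)%R.
Proof.
move=> km; rewrite /beta_coef -signr_odd addnS /=.
have [mk|mk] := boolP (odd (m + k)).
  have /= -> : ~~ odd m && (k.+1 == 1) = false by case: k mk {km} => [|k]; lia.
  have [d mE] : exists d, m = (d.*2 + k).+1 by exists (m - k)./2; lia.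
  have -> : ((m + k).+1)./2 - 1 = d + k by lia.
  have -> : (m - k.+1)./2 + 1 = d.+1 by lia.
  have mE' : m = d.+1 + (d + k) by lia.
  rewrite subn1 /= expr1 mulN1r mulNr; congr (- _)%R.
  apply: (@mulIf _ (odd_prod d.+1)%:Z); first by rewrite eqz_nat -lt0n odd_prod_gt0.
  rewrite -mulrA {1}mE' Rprod_odd_prod; last by lia.
  by rewrite -!PoszM bin_odd_prod_odd -mE.
rewrite /= mul1r; case: k km mk => [|j] km mk.
  have -> /= : ~~ odd m by lia.
  by rewrite bessel_poly_coef0.
have -> : ~~ odd m && (j.+2 == 1) = false by lia.
rewrite /=.
have [e mE] : exists e, m = e.*2 + j.+1 by exists (m - j)./2; lia.
have -> : ((m + j.+1).+1 - 3)./2 = e + j by lia.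
have -> : (m + 3 - j.+2)./2 = e.+1 by lia.
have -> : j.+2 - 1 = j.+1 by lia.
have -> : j.+2 - 2 = j by lia.
have mE' : m = e.+1 + (e + j) by lia.
have := bin_odd_prod_even e j.+1; rewrite -mE addnS => b1.
have b2 : (Rprod e.+1 (e + j) m * (odd_prod e.+1)%:Z = (odd_prod (e + j).+1)%:Z)%R.
  by rewrite {1}mE' Rprod_odd_prod//; lia.
have b3 : j.+1 * 'C(e + j, j.+1) = e * 'C(e + j, j).
  by rewrite mul_bin_left addnK.
have b4 : (e + j).+1 * 'C(e + j, j) = j.+1 * 'C((e + j).+1, j.+1).
  exact: mul_bin_diag.
have b5 : j.+1 * ((m + j.+2) * 'C(e + j, j.+1) + 'C(e + j, j)) =
    e.*2.+1 * (j.+1 * 'C((e + j).+1, j.+1)).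
  rewrite -b4 mulnDr mulnCA b3 mE -!muln2; move: ('C(e + j, j)); by clear => c; nia.
have b6 : j.+1 * (((m + j.+2) * 'C(e + j, j.+1) + 'C(e + j, j)) * odd_prod (e + j).+1) =
  j.+1 * (bessel_poly_coef m j.+1 * odd_prod e.+1).
  rewrite mulnA b5 [odd_prod e.+1]odd_prodS; move: (f_equal (muln (e.*2.+1 * j.+1)) b1).
  rewrite -!mulnA => ->.
  by rewrite [LHS]mulnCA [X in j.+1 * X = _]mulnC -!mulnA.
apply: (@mulIf _ (odd_prod e.+1)%:Z); first by rewrite eqz_nat -lt0n odd_prod_gt0.
rewrite -mulrA b2 -!PoszM; congr Posz.
by apply/eqP; rewrite -(@eqn_pmul2l j.+1)//; apply/eqP; rewrite -b6; lia.
Qed.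

End Coefficients.

(** * The explicit sum *)

Section ExplicitSum.
Variable R : realType.
Implicit Types (z x : R[i]).
Local Notation ii := ('i%C : R[i]).

Definition bessel_poly m x : R[i] :=
  \sum_(0 <= k < m.+1) (bessel_poly_coef m k)%:R * x ^+ k.

(** The vanishing coefficients allow the sums of the recurrence to share one range. *)
Lemma bessel_poly_wide m N x : (m < N)%N ->
  bessel_poly m x = \sum_(0 <= k < N) (bessel_poly_coef m k)%:R * x ^+ k.
Proof.
move=> mN; rewrite (@big_cat_nat _ _ _ m.+1) //= [X in _ + X]big1_seq ?addr0 //.
by move=> k; rewrite mem_index_iota => /andP[_ /andP[mk _]];
  rewrite bessel_poly_coef_small// mul0r.
Qed.

Lemma bessel_poly_rec m x :
  bessel_poly m.+2 x = (m.*2.+3)%:R * x * bessel_poly m.+1 x + bessel_poly m x.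
Proof.
rewrite (@bessel_poly_wide m m.+3)//; last by lia.
rewrite /bessel_poly big_nat_recl// [X in _ = _ +
  X]big_nat_recl// !bessel_poly_coef0 addrCA; congr (_ + _).
rewrite big_distrr -big_split /=; apply: eq_bigr => k _.
by rewrite bessel_poly_coef_rec natrD natrM exprS; ring.
Qed.

Lemma hbessel_poly z m : z != 0 ->
  hbessel z m.+1 = - ii * ((- ii) ^+ m * expc (ii * z) * bessel_poly m (ii / z)
                       - ii ^+ m * expc (- (ii * z)) * bessel_poly m (- ii / z)).
Proof.
move=> z0.
have bp0 x : bessel_poly 0 x = 1 by rewrite /bessel_poly big_nat1 bessel_poly_coef0 mulr1.
have bp1 x : bessel_poly 1 x = 1 + x.
  by rewrite /bessel_poly big_nat_recr//= big_nat1 !bessel_poly_coef0 /bessel_poly_coef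
    /odd_prod big_nat1 binn !mul1r expr1.
elim/ltn_ind: m => -[|[|m]] IH.
- by rewrite !bp0 /= iiV; ring.
- rewrite hbesselSS !bp1 /= iiV !expr1 mulNr mulrN.
  rewrite [RHS](_ : _ = ii * ii * (expc (ii * z) * (1 + ii / z) +
    expc (- (ii * z)) * (1 - ii / z))).
    by rewrite ii2 double0; field.
  by field.
rewrite hbesselSS !IH // !bessel_poly_rec !exprS.
set A := (- ii) ^+ m; set B := ii ^+ m; set p := bessel_poly _ _; set q := bessel_poly _ _.
set p' := bessel_poly _ _; set q' := bessel_poly _ _; set e := expc _; set e' := expc _.
rewrite [RHS](_ : _ = ii * ii * (- ii * (A * e * (m.*2.+3%:R * (ii / z) * p + p') -
    B * e' * (m.*2.+3%:R * (- ii / z) * q + q')))); last by ring.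
by rewrite ii2 doubleS; field.
Qed.

Lemma half_powE z n : half_pow z n = z ^+ n * sqrtc z.
Proof. by rewrite /half_pow exprSr -mul2n exprM sqr_sqrtc. Qed.

Lemma beta_coef_sum z m : z != 0 ->
  \sum_(1 <= n < m.+2)
       (beta_coef m n)%:~R *
       (expc (ii * z) / (ii ^ (n%:Z - m%:Z) * half_pow z n.-1) +
        (-1) ^+ (n + m) *
        (expc (- (ii * z)) / (ii ^ (n%:Z - m%:Z) * half_pow z n.-1)))
  = hbessel z m.+1 / sqrtc z.
Proof.
move=> z0; have q0 : sqrtc z != 0 by rewrite sqrtc_eq0.
rewrite hbessel_poly// /bessel_poly big_add1 /= !big_distrr /= -sumrB big_distrr
  big_distrl /=.
rewrite !big_nat; apply: eq_bigr => k /andP[_ km].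
rewrite beta_coefE; last by lia.
rewrite half_powE intrM -pmulrn rmorphXn rmorphN1 /=.
have ii0 := @ii_neq0 R.
have -> : ii ^ (k.+1%:Z - m%:Z) = ii ^+ k * ii / ii ^+ m.
  by rewrite expfzDr// -exprnN -exprnP exprSr.
have KV : (ii ^+ k)^-1 = (-1) ^+ k * ii ^+ k by rewrite -exprVn iiV (exprNn ii).
rewrite addSn exprS !exprMn !(exprNn ii) [(k + m)%N]addnC !exprD exprVn !invfM invrK KV iiV.
have ss : (-1) ^+ m * (-1) ^+ m = 1 :> R[i] by rewrite -exprMn mulrNN mulr1 expr1n.
have tt : (-1) ^+ k * (-1) ^+ k = 1 :> R[i] by rewrite -exprMn mulrNN mulr1 expr1n.
move: ss tt; set S := (-1) ^+ m; set T := (-1) ^+ k; set A := ii ^+ m; set K := ii ^+ k.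
set e := expc _; set e' := expc _; set b := _%:R => ss tt.
rewrite [LHS](_ : _ = (z ^+ k)^-1 / sqrtc z * b * ii *
  ((S * S) * (T * T) * T * e' - S * (T * T) * e) * A * K); last by ring.
by rewrite ss tt; ring.
Qed.

End ExplicitSum.

(** * Power series converging everywhere *)

Section Entire.
Variable R : realType.
Implicit Types (z : R[i]) (a b d : nat -> R[i]) (E F G : R[i] -> R[i]).
Local Notation ii := ('i%C : R[i]).

Definition power_series a E := forall z,
  series (fun k => a k * z ^+ k : R[i]^o) @ \oo --> (E z : R[i]^o).

Lemma cvg_nrm (u : nat -> R[i]) (l : R[i]) :
  ((u : nat -> R[i]^o) @ \oo --> (l : R[i]^o)) <->
  (nrm (u n - l) @[n --> \oo] --> (0 : R)).
Proof.
split=> [/cvgrPdist_lt ul|ul].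
  apply/cvgr0Pnorm_lt => e e0; have : 0 < e%:C by rewrite ltcR.
  move=> /ul; apply: filterS => n.
  by rewrite distrC -nrmE ltcR ger0_norm ?nrm_ge0.
apply/cvgrPdist_lt => e; rewrite ltcE /= => /andP[/eqP ei er].
move/cvgr0Pnorm_lt: ul => /(_ _ er); apply: filterS => n.
rewrite distrC -nrmE ger0_norm ?nrm_ge0// => h.
by rewrite ltcE /= ei eqxx.
Qed.

Lemma power_series_nrm a E : power_series a E <->
  forall z, nrm (\sum_(0 <= k < n) a k * z ^+ k - E z) @[n --> \oo] --> (0 : R).
Proof. by split=> aE z; apply/cvg_nrm; exact: aE. Qed.

Lemma cvg0D (u v : nat -> R) : u n @[n --> \oo] --> (0 : R) ->
  v n @[n --> \oo] --> (0 : R) -> u n + v n @[n --> \oo] --> (0 : R).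
Proof. by move=> u0 v0; rewrite -[X in _ --> X]addr0; exact: cvgD. Qed.

Lemma cvg0Z (x : R) (u : nat -> R) : u n @[n --> \oo] --> (0 : R) ->
  x * u n @[n --> \oo] --> (0 : R).
Proof.
by move=> u0; rewrite -[X in _ --> X](mulr0 x); apply: cvgM => //; exact: cvg_cst.
Qed.

Lemma power_seriesD a b E F : power_series a E -> power_series b F ->
  power_series (fun k => a k + b k) (fun z => E z + F z).
Proof.
move=> /power_series_nrm aE /power_series_nrm bF; apply/power_series_nrm => z.
apply: (cvg0_dominated (v := fun n => nrm (\sum_(0 <= k < n) a k * z ^+ k - E z) +
  nrm (\sum_(0 <= k < n) b k * z ^+ k - F z))).
  apply: nearW => n; rewrite ger0_norm ?nrm_ge0//.
  under eq_bigr do rewrite mulrDl.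
  rewrite big_split /= opprD addrACA; exact: nrmD.
exact: cvg0D (aE z) (bF z).
Qed.

Lemma power_seriesZ c a E : power_series a E ->
  power_series (fun k => c * a k) (fun z => c * E z).
Proof.
move=> /power_series_nrm aE; apply/power_series_nrm => z.
apply: (cvg0_dominated (v := fun n => nrm c * nrm (\sum_(0 <= k < n) a k * z ^+ k - E z))).
  apply: nearW => n; rewrite ger0_norm ?nrm_ge0//.
  under eq_bigr do rewrite -mulrA.
  rewrite -big_distrr -mulrBr nrmM; exact: lexx.
exact: cvg0Z (aE z).
Qed.

Lemma power_series_ext a b E F : a =1 b -> E =1 F -> power_series a E -> power_series b F.
Proof. by move=> /funext <- /funext <-. Qed.

Lemma power_seriesB a b E F : power_series a E -> power_series b F ->
  power_series (fun k => a k - b k) (fun z => E z - F z).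
Proof.
move=> aE /(power_seriesZ (c := -1)) bF.
by apply: power_series_ext (power_seriesD aE bF) => x; rewrite mulN1r.
Qed.

(** Division of a power series without constant term by the variable. *)
Lemma power_series_shift b G : power_series b (fun z => z * G z) -> b 0 = 0 -> G 0 = b 1 ->
  power_series (fun k => b k.+1) G.
Proof.
move=> /power_series_nrm bG b0 G0; apply/power_series_nrm => z.
have [->|z0] := eqVneq z 0.
  apply: (cvg0_dominated (v := cst 0)); last exact: cvg_cst.
  exists 1%N => // -[//|n] _ /=.
  rewrite big_nat_recl// big1 ?addr0; last by move=> k _; rewrite expr0n mulr0.
  by rewrite expr0 mulr1 G0 subrr nrm0 normr0.
have := cvg0Z (nrm z)^-1 (bG z); rewrite -cvg_shiftS; apply: cvg0_dominated.
apply: nearW => n; rewrite ger0_norm ?nrm_ge0// -nrmV -nrmM.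
rewrite big_nat_recl//= b0 mul0r add0r mulrBr mulKf// mulr_sumr.
rewrite [X in _ <= nrm (X - _)](eq_bigr (fun k => b k.+1 * z ^+ k)) //.
by move=> k _; rewrite exprS mulrCA mulKf.
Qed.

(** Taylor's remainder after n terms is the integral of the remainder after n - 1
terms, hence at most exp |z| |z|^n / n! by induction. *)
Lemma expc_power_series c : power_series (fun k => c ^+ k / (k`!)%:R)
  (fun z => expc (c * z)).
Proof.
apply/power_series_nrm => z0.
under eq_fun do under eq_bigr do rewrite mulrAC -exprMn.
set z := c * z0; clearbody z.
pose r n (t : R) : R[i] := expc (z * t%:C) - \sum_(0 <= k < n) (z * t%:C) ^+ k / (k`!)%:R.
have tD : cderiv (fun t : R => z * t%:C) (fun=> z).
  by apply: cderiv_ext (cderivZ z (@cderiv_id R)) => t //; rewrite mulr1.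
have sD n : cderiv (fun t : R => \sum_(0 <= k < n.+1) (z * t%:C) ^+ k / (k`!)%:R)
    (fun t => z * \sum_(0 <= k < n) (z * t%:C) ^+ k / (k`!)%:R).
  elim: n => [|n IH].
    apply: cderiv_ext (cderiv_cst 1) => t; first by rewrite big_nat1 expr0 invr1 mulr1.
    by rewrite big_nil mulr0.
  apply: cderiv_ext (cderivD IH (cderivM (cderivX n.+1 tD) (cderiv_cst (n.+1`!%:R)^-1)))
    => t.
    by rewrite [RHS]big_nat_recr.
  rewrite [in RHS]big_nat_recr//= factS natrM; field.
  by rewrite nat1r !pnatr_eq0 -lt0n fact_gt0.
have rD n : cderiv (r n.+1) (fun t => z * r n t).
  apply: cderiv_ext (cderivB (cderiv_expc tD) (sD n)) => t //.
  by rewrite /r mulrBr [X in X - _]mulrC.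
have rle n : forall t, 0 <= t <= 1 -> nrm (r n t) <= expR (nrm z) * (nrm z ^+ n * t ^+ n
  / (n`!)%:R).
  elim: n => [|n IH] t /andP[t0 t1].
    rewrite /r big_nil subr0 nrm_expc !expr0 !mul1r invr1 mulr1 ler_expR.
    rewrite (le_trans (ler_norm _))// (le_trans (Re_le_nrm _))// nrmM nrm_real ger0_norm//.
    by rewrite ler_piMr// nrm_ge0.
  pose g (u : R) := expR (nrm z) * (nrm z ^+ n.+1 * u ^+ n.+1 / (n.+1`!)%:R).
  pose dg (u : R) := nrm z * (expR (nrm z) * (nrm z ^+ n * u ^+ n / (n`!)%:R)).
  have gD (u : R) : is_derive u (1 : R) g (dg u).
    pose K := expR (nrm z) * nrm z ^+ n.+1 / (n.+1`!)%:R.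
    have XD : is_derive u (1 : R) (fun v : R => v ^+ n.+1) (n.+1%:R * u ^+ n).
      by split; [exact: exprn_derivable|rewrite exp_derive /GRing.scale /= mulr1].
    have -> : g = (fun v : R => K * v ^+ n.+1).
      by apply/funext => v; rewrite /g /K; ring.
    apply: (is_derive_eq (is_deriveZ K XD)).
    rewrite /GRing.scale /= /K /dg factS natrM exprS; field.
    by rewrite nat1r !pnatr_eq0 -lt0n fact_gt0.
  have := cmean_value t0 (rD n) gD.
  have -> : r n.+1 0 = 0.
    rewrite /r rmorph0 mulr0 expc0 big_nat_recl// expr0 invr1 mulr1 big1 ?addr0 ?subrr//.
    by move=> k _; rewrite expr0n mul0r.
  have -> : g 0 = 0 by rewrite /g expr0n /= mulr0 mul0r mulr0.
  rewrite !subr0; apply => u /andP[u0 ut]; rewrite nrmM ler_wpM2l ?nrm_ge0// IH// u0.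
  exact: le_trans t1.
apply: (cvg0_dominated (v := fun n => expR (nrm z) * exp_coeff (nrm z) n)).
  apply: nearW => n; rewrite ger0_norm ?nrm_ge0// nrmB.
  have := rle n 1; rewrite ler01 lexx /r mulr1 expr1n mulr1; exact.
apply: cvg0Z; exact: (cvg_series_cvg_0 (is_cvg_series_exp_coeff (nrm z))).
Qed.

End Entire.

(** * The entire function z^(- (m + 1/2)) J_(m + 1/2) (z) *)

Section EntireBessel.
Variable R : realType.
Implicit Types (z : R[i]) (a b d : nat -> R[i]) (E F G : R[i] -> R[i]).
Local Notation ii := ('i%C : R[i]).

(** Taylor coefficients: 2 (- 1)^k / (2^k k! (2n + 2k - 1)!!) in degree 2k. *)
Definition hbessel_coef n j : R[i] :=
  if odd j then 0
  else 2 * (-1) ^+ j./2 / (2 ^+ j./2 * (j./2)`!%:R * (odd_prod (n + j./2))%:R).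

Definition hbessel_entire n z : R[i] :=
  if z == 0 then hbessel_coef n 0 else hbessel z n / z ^+ n.

Lemma natr_neq0 (n : nat) : (0 < n)%N -> n%:R != 0 :> R[i].
Proof. by move=> n0; rewrite pnatr_eq0 -lt0n. Qed.

Lemma hbessel_coef_rec n j :
  hbessel_coef n.+2 j = (n.*2.+1)%:R * hbessel_coef n.+1 j.+2 - hbessel_coef n j.+2.
Proof.
rewrite /hbessel_coef !oddS negbK; case: (odd j); first by rewrite mulr0 subr0.
rewrite [j.+2./2]/= ; set k := j./2.
have -> : (n.+2 + k)%N = (n + k).+2 by [].
have -> : (n.+1 + k.+1)%N = (n + k).+2 by lia.
have -> : (n + k.+1)%N = (n + k).+1 by lia.
rewrite (odd_prodS (n + k).+1) factS !exprS !natrM.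
have d0 := natr_neq0 (odd_prod_gt0 (n + k).+1).
have f0 := natr_neq0 (fact_gt0 k).
have k0 := natr_neq0 (ltn0Sn k).
have q0 := natr_neq0 (ltn0Sn (n + k).+1.*2).
have P0 : 2 ^+ k != 0 :> R[i] by rewrite expf_neq0// pnatr_eq0.
have qE : (((n + k).+1).*2.+1)%:R = (n.*2.+1)%:R + 2 * (k.+1)%:R :> R[i].
  by rewrite -natrM -natrD; congr _%:R; lia.
move: q0 d0 f0 k0 P0; rewrite qE.
move: (odd_prod _)%:R (k`!)%:R (k.+1)%:R (2 ^+ k) (n.*2.+1)%:R ((-1) ^+ k).
move=> x y k1 p q e q0 x0 y0 k0 p0; field.
by rewrite p0 y0 x0 q0 k0.
Qed.

(** This makes the division by z^2 in the recurrence possible. *)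
Lemma hbessel_coef_vanish n j : (j < 2)%N ->
  (n.*2.+1)%:R * hbessel_coef n.+1 j - hbessel_coef n j = 0.
Proof.
case: j => [|[|//]] _; rewrite /hbessel_coef; last by rewrite mulr0 subr0.
rewrite [0./2]/= [odd 0]/= !addn0 odd_prodS natrM fact0.
have x0 := natr_neq0 (odd_prod_gt0 n).
have q0 := natr_neq0 (ltn0Sn n.*2).
by move: (odd_prod n)%:R (n.*2.+1)%:R x0 q0 => x q x0 q0; field; rewrite x0 q0.
Qed.

Lemma iiXN (k : nat) : (- ii) ^+ k = (-1) ^+ odd k * ii ^+ k.
Proof. by rewrite (exprNn ii) signr_odd. Qed.

Lemma iiX (k : nat) : ii ^+ k = (-1) ^+ k./2 * ii ^+ odd k.
Proof. by rewrite -[in LHS](odd_double_half k) addnC exprD -mul2n exprM sqr_i. Qed.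

Lemma expc_pm_power_series (s : R[i]) :
  power_series (fun k => (ii ^+ k + s * (- ii) ^+ k) / (k`!)%:R)
       (fun z => expc (ii * z) + s * expc (- (ii * z))).
Proof.
apply: power_series_ext (power_seriesD (expc_power_series (c := ii)) (power_seriesZ (c :=
  s) (expc_power_series (c := - ii)))) => k.
  by ring.
by rewrite mulNr.
Qed.

(** If E_n is hbessel z n / z^n, the recurrence reads
z^2 E_(n+2) = (2n+1) E_(n+1) - E_n, and two divisions by z are possible on the
level of coefficients. *)
Lemma hbessel_entire_power_series n : power_series (hbessel_coef n) (hbessel_entire n).
Proof.
elim/ltn_ind: n => -[|[|n]] IH.
- apply: power_series_ext (expc_pm_power_series (s := 1)) => [j|z]; last first.
    rewrite mul1r /hbessel_entire expr0 divr1 /=; case: eqVneq => // ->.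
    by rewrite mulr0 oppr0 expc0 /hbessel_coef /= /odd_prod big_nil fact0; field.
  rewrite mul1r /hbessel_coef iiXN iiX; have [jo|je] := boolP (odd j).
    by rewrite expr1; ring.
  have -> : j`! = (j./2.*2)`! by congr (_`!); lia.
  rewrite fact_double !natrM natrX expr0.
  have x0 := natr_neq0 (odd_prod_gt0 j./2); have f0 := natr_neq0 (fact_gt0 j./2).
  by field; rewrite x0 f0 expf_neq0// pnatr_eq0.
- have D := power_seriesZ (c := - ii) (expc_pm_power_series (s := -1)).
  have D1 : power_series _ (fun z => z * hbessel_entire 1 z) := power_series_ext (fun=>
    erefl) _ D.
  apply: power_series_ext (power_series_shift (D1 _) _ _) => [j|//|z||].
  + rewrite mulN1r iiXN iiX /hbessel_coef /=; have [jo|je] := boolP (odd j).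
      by rewrite /= expr0; ring.
    have -> : j.+1`! = (j./2.*2.+1)`! by congr (_`!); lia.
    have -> : uphalf j = j./2 by lia.
    rewrite fact_doubleS !natrM natrX expr1.
    have x0 := natr_neq0 (odd_prod_gt0 j./2.+1); have f0 := natr_neq0 (fact_gt0 j./2).
    rewrite [LHS](_ : _ = - (ii * ii) * (2 * (-1) ^+ j./2 / ((odd_prod j./2.+1)%:R * (2
      ^+ j./2 * (j./2)`!%:R)))).
      by rewrite ii2; field; rewrite x0 f0 expf_neq0// pnatr_eq0.
    by field; rewrite x0 f0 expf_neq0// pnatr_eq0.
  + rewrite mulN1r /hbessel_entire; case: eqVneq => [->|z0].
      by rewrite mulr0 oppr0 expc0 subrr mulr0 mul0r.
    by rewrite expr1 mulrCA divff// mulr1 /= iiV mulrC.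
  + by rewrite !expr0; ring.
  + rewrite /hbessel_entire eqxx /hbessel_coef /= !expr1 /odd_prod big_nat1 fact0.
    rewrite double0 factS fact0 muln1 [RHS](_ : _ = - (ii * ii) * 2); last by field.
    by rewrite ii2; field.
have D := power_seriesB (power_seriesZ (c := (n.*2.+1)%:R) (IH n.+1 (ltnSn _))) (IH n
  (leqnSn _)).
have v0 := hbessel_coef_vanish n (isT : (0 < 2)%N).
have v1 := hbessel_coef_vanish n (isT : (1 < 2)%N).
have D1 : power_series (fun k => (n.*2.+1)%:R * hbessel_coef n.+1 k.+1 -
  hbessel_coef n k.+1) (fun z => z * hbessel_entire n.+2 z).
  apply: (power_series_shift (b := fun k => (n.*2.+1)%:R * hbessel_coef n.+1 k -
    hbessel_coef n k)).
  - apply: power_series_ext D => // z; rewrite /hbessel_entire; case: eqVneq => [->|z0].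
      by rewrite mul0r v0.
    by rewrite hbesselSS !exprS; field; rewrite z0 expf_neq0.
  - exact: v0.
  - by rewrite mul0r v1.
apply: power_series_ext (power_series_shift D1 v1 _) => [j|//|].
  by rewrite hbessel_coef_rec.
by rewrite /hbessel_entire eqxx -hbessel_coef_rec.
Qed.

End EntireBessel.

(** * Uniqueness of power series and the representation *)

Section Uniqueness.
Variable R : realType.
Implicit Types (z : R[i]) (a b d : nat -> R[i]) (E F G D : R[i] -> R[i]).
Local Notation ii := ('i%C : R[i]).

Lemma power_series_bounded d D : power_series d D -> exists2 M : R, 0 <= M & forall k,
  nrm (d k) <= M.
Proof.
move=> /(_ 1) /cvgP /cvg_series_cvg_0 /cvg_nrm.
under eq_fun do rewrite expr1n mulr1 subr0.
move=> /cvgP /cvg_seq_bounded [M [_ /(_ (`|M| + 1))]].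
rewrite (le_lt_trans (ler_norm _)) ?ltrDl// => /(_ isT) dM.
exists (`|M| + 1); first by rewrite addr_ge0.
by move=> k; have := dM k I; rewrite /= ger0_norm ?nrm_ge0.
Qed.

(** The coefficients are bounded by some M, since the series converges at 1; hence
the series differs from its constant term by at most 2 M x when x <= 1/2. *)
Lemma power_series_coef0 d D : power_series d D ->
  (forall x : R, 0 < x -> D x%:C = 0) -> d 0 = 0.
Proof.
move=> dD D0; have [M M0 dM] := power_series_bounded dD.
have bnd x n : 0 < x -> x <= 2^-1 ->
    nrm (\sum_(0 <= k < n.+1) d k * x%:C ^+ k - d 0) <= 2 * M * x.
  move=> x0 x1; rewrite big_nat_recl// expr0 mulr1 addrC addKr.
  have sle : forall j, nrm (\sum_(0 <= k < n) d (k + j)%N * x%:C ^+ k) <= 2 * M.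
    elim: n => [|n IH] j; first by rewrite big_nil nrm0 mulr_ge0.
    rewrite big_nat_recl// expr0 mulr1 (le_trans (nrmD _ _))//.
    rewrite (eq_bigr (fun k => x%:C * (d (k + j.+1)%N * x%:C ^+ k))); last first.
      by move=> k _; rewrite exprS addSnnS mulrCA.
    rewrite -mulr_sumr nrmM nrm_real ger0_norm ?(ltW x0)//.
    have := IH j.+1; have := dM j; have := nrm_ge0 (\sum_(0 <= k < n) d (k +
      j.+1)%N * x%:C ^+ k).
    set S := nrm _; rewrite add0n => S0 dj SM.
    have : x * S <= 2^-1 * (2 * M) by rewrite ler_pM ?(ltW x0).
    lra.
  rewrite (eq_bigr (fun k => x%:C * (d (k + 1)%N * x%:C ^+ k))); last first.
    by move=> k _; rewrite exprS addn1 mulrCA.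
  by rewrite -mulr_sumr nrmM nrm_real ger0_norm ?(ltW x0)// mulrC ler_wpM2r ?(ltW x0).
have d0x x : 0 < x -> x <= 2^-1 -> nrm (d 0) <= 2 * M * x.
  move=> x0 x1; apply/ler_addgt0Pr => e e0.
  have := (power_series_nrm d D).1 dD x%:C; rewrite D0// =>
    /cvgr0Pnorm_lt/(_ _ e0) [N _ Ne].
  have := Ne N.+1 (leqnSn _); have := bnd _ N x0 x1.
  rewrite /= subr0 ger0_norm ?nrm_ge0//; set S := \sum_(_ <= _ < _) _ => h1 h2.
  have := nrmD (d 0 - S) S; rewrite subrK [nrm (d 0 - S)]nrmB => /le_trans; apply.
  by rewrite lerD// ltW.
apply/eqP; rewrite -nrm_eq0 eq_le nrm_ge0 andbT.
apply/ler_addgt0Pr => e e0; rewrite add0r.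
pose x := Num.min 2^-1 (e / (2 * M + 1)).
have M1 : 0 < 2 * M + 1 by rewrite ltr_wpDl// mulr_ge0.
have x0 : 0 < x by rewrite lt_min invr_gt0 ltr0n divr_gt0.
rewrite (le_trans (d0x x x0 _))//; first by rewrite ge_min lexx.
have : x <= e / (2 * M + 1) by rewrite ge_min lexx orbT.
rewrite ler_pdivlMr//; lra.
Qed.

Lemma power_series_fun a E F : power_series a E -> power_series a F -> E = F.
Proof.
move=> aE aF; apply/funext => z.
exact: (norm_cvg_unique (aE z) (aF z)).
Qed.

Lemma power_series_at0 d D : power_series d D -> D 0 = d 0.
Proof.
move=> /(_ 0) dD; suff : series (fun k => d k * 0 ^+ k : R[i]^o) @ \oo --> (d 0 : R[i]^o).
  exact: (norm_cvg_unique dD).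
apply/cvg_nrm; apply: (cvg0_dominated (v := cst 0)); last exact: cvg_cst.
exists 1%N => // -[//|n] _ /=.
rewrite /series /= big_nat_recl// expr0 mulr1 big1 ?addr0 ?subrr ?nrm0 ?normr0//.
by move=> k _; rewrite expr0n mulr0.
Qed.

Lemma power_series_zero d D : power_series d D ->
  (forall x : R, 0 < x -> D x%:C = 0) -> d = fun=> 0.
Proof.
move=> dD D0; apply/funext => k; elim: k d D dD D0 => [|k IH] d D dD D0.
  exact: power_series_coef0 dD D0.
have d0 := power_series_coef0 dD D0.
have D00 : D 0 = 0 by rewrite (power_series_at0 dD).
pose G z := if z == 0 then d 1%N else D z / z.
apply: (IH (fun j => d j.+1) G).
  apply: (@power_series_shift _ d G _ d0); last by rewrite /G eqxx.
  have DG : D =1 (fun z => z * G z).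
    move=> z; rewrite /G; case: eqVneq => [->|z0]; first by rewrite mul0r.
    by rewrite mulrCA divff// mulr1.
  exact: (power_series_ext (fun=> erefl) DG dD).
move=> x x0; rewrite /G D0// mul0r ifF//.
by apply/eqP => -[xx]; rewrite xx ltxx in x0.
Qed.

Lemma entire_unique E F : entire E -> entire F ->
  (forall z, 0 < Re z -> E z = F z) -> E = F.
Proof.
move=> [a aE] [b bF] EF; have D := power_seriesB aE bF.
have ab : a = b.
  have d0 k h : a k - b k = 0 := congr1 (fun f : nat ->
    R[i] => f k) (power_series_zero D h).
  apply/funext => k; apply/eqP; rewrite -subr_eq0; apply/eqP.
  by apply: (d0 k) => x x0; rewrite EF ?subrr.
rewrite ab in aE; exact: (@power_series_fun b E F aE bF).
Qed.

Lemma half_pow_hbessel_entire m z : z != 0 -> half_pow z m * hbessel_entire m.+1 z =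
  hbessel z m.+1 / sqrtc z.
Proof.
move=> z0; rewrite half_powE /hbessel_entire (negPf z0).
set Y := hbessel z _; set q := sqrtc z.
have q0 : q != 0 by rewrite sqrtc_eq0.
have qV : q / z = q^-1 by rewrite -[z]sqr_sqrtc -/q; field.
by rewrite -qV exprS; field; rewrite z0 expf_neq0.
Qed.

Lemma schlafli_hbessel_entire m z : 0 <= Re z -> z != 0 ->
  schlafli m z = half_pow z m * (((Num.sqrt (2 * pi))^-1)%:C * hbessel_entire m.+1 z).
Proof. by move=> Rez z0; rewrite schlafli_hbessel// [RHS]mulrCA half_pow_hbessel_entire.
  Qed.

(** Both functions are entire, and on the open right half-plane both are the integral
formula divided by a nonzero power of z. *)
Lemma bessel_entireE m :
  bessel_entire m = fun z => ((Num.sqrt (2 * pi))^-1)%:C * hbessel_entire m.+1 z.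
Proof.
pose E0 (z : R[i]) := ((Num.sqrt (2 * pi))^-1)%:C * hbessel_entire m.+1 z.
have E0P : [set E : R[i] -> R[i] | entire E /\
       forall z : R[i], 0 < Re z -> schlafli m z = half_pow z m * E z] E0.
  split; first by exists (fun k => ((Num.sqrt (2 * pi))^-1)%:C * hbessel_coef R m.+1 k);
    exact: power_seriesZ (@hbessel_entire_power_series R m.+1).
  move=> z z0; apply: schlafli_hbessel_entire; first exact: ltW.
  by apply: contraTneq z0 => ->; rewrite ltxx.
have [] := xgetPex (fun=> 0) (ex_intro _ E0 E0P); rewrite -/(bessel_entire m) => eE hE.
apply: (entire_unique eE E0P.1) => z z0.
have zn0 : z != 0 by apply: contraTneq z0 => ->; rewrite ltxx.
have h0 : half_pow z m != 0 by rewrite half_powE mulf_neq0 ?expf_neq0// sqrtc_eq0.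
by apply: (mulfI h0); rewrite -(hE z z0) -(E0P.2 z z0).
Qed.

(** At 0 both integrals are elementary: they are (- 1)^m / nu and 1 / nu with
nu = m + 1/2, and the sign (- 1)^(m+1) makes them cancel. *)
Lemma schlafli0 m : schlafli m (0 : R[i]) = 0.
Proof.
pose nu : R := m%:R + 2^-1.
have nu0 : 0 < nu by rewrite /nu ltr_wpDl.
have nuC0 : nu%:C != 0 by rewrite -(rmorph0 (real_complex R)) (inj_eq (@complexI R)) gt_eqF.
have ii0 := @ii_neq0 R.
have eD (c : R[i]) : cderiv (fun t : R => expc (c * t%:C)) (fun t => c * expc (c * t%:C)).
  by apply: cderiv_ext (cderiv_expc (cderivZ c (@cderiv_id R))) => t //; ring.
rewrite /schlafli.
have -> : (fun t : R => cosc ((nu * t)%:C - 0 * (sin t)%:C)) =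
    (fun t => (2 * ii * nu%:C)^-1 * (ii * nu%:C * expc (ii * nu%:C * t%:C) -
       (- (ii * nu%:C)) * expc (- (ii * nu%:C) * t%:C))).
  apply/funext => t; rewrite mul0r subr0 /cosc rmorphM !mulNr !mulrA; field.
  by rewrite ii0 nuC0.
have D1 := cderivZ (2 * ii * nu%:C)^-1 (cderivB (eD (ii * nu%:C)) (eD (- (ii * nu%:C)))).
have D1' := cderivZ (2 * ii * nu%:C)^-1 (cderivB (cderivZ (ii * nu%:C) (eD (ii * nu%:C)))
  (cderivZ (- (ii * nu%:C)) (eD (- (ii * nu%:C))))).
rewrite (cintegral_FTC (pi_gt0 R) (cderiv_continuous D1') D1).
have -> : (fun t : R => expc (- (0 * (sinhr t)%:C) - (nu * t)%:C)) =
   (fun t => (- nu%:C)^-1 * (- nu%:C * expc (- nu%:C * t%:C))).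
  by apply/funext => t; rewrite mul0r oppr0 add0r rmorphM !mulNr; field.
have D2 := cderivZ (- nu%:C)^-1 (eD (- nu%:C)).
have D2' := cderivZ (- nu%:C)^-1 (cderivZ (- nu%:C) (eD (- nu%:C))).
rewrite (cintegral_FTCy (c := nu) (l := 0) nu0 (cderiv_continuous D2') D2); last 2 first.
- move=> t t0; rewrite mulKf ?oppr_eq0// -rmorphN -rmorphM expc_real nrm_real mulNr.
  by rewrite ger0_norm ?expR_ge0.
- apply: (cvgcy_le (g := fun t => nu^-1 * expR (- (nu * t)))).
    apply: nearW => t; rewrite subr0 nrmM nrmV nrmN nrm_real ger0_norm ?(ltW nu0)//.
    by rewrite -rmorphN -rmorphM expc_real nrm_real mulNr ger0_norm ?expR_ge0.
  rewrite -[X in _ --> X](mulr0 nu^-1); apply: cvgM; first exact: cvg_cst.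
  apply: (@cvg_comp _ _ _ (fun t => nu * t) (fun t => expR (- t))); last exact: cvgr_expR.
  exact: gt0_cvgMry.
rewrite rmorph0 !mulr0 !expc0 subrr mulr0 subr0 sub0r mulr1 mulNr expcN.
have -> : expc (ii * nu%:C * pi%:C) = (-1) ^+ m * ii.
  have -> : ii * nu%:C * pi%:C = (ii * (pi / 2)%:C) *+ m.*2.+1.
    rewrite -[RHS]mulr_natr -[(m.*2.+1)%:R]natr1 -muln2 natrM /nu rmorphD rmorphM
      !fmorphV !rmorph_nat.
    by field.
  by rewrite expcMn expc_ipi2 exprSr -mul2n exprM sqr_i.
have eV : ((-1) ^+ m * ii)^-1 = - ((-1) ^+ m * ii).
  by rewrite invfM iiV mulrN -exprVn invrN1.
by rewrite eV exprS; move: (_^-1)%:C => c; field; rewrite nuC0 ii0.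
Qed.

End Uniqueness.

Theorem lemma3 (R : realType) :
  (forall m : nat, besselJ_half m (0 : R[i]) = 0) /\
  (forall (m : nat) (z : R[i]), z != 0 ->
     besselJ_half m z =
     ((Num.sqrt (2 * pi))^-1)%:C *
     \sum_(1 <= n < m.+2)
       (beta_coef m n)%:~R *
       (expc ('i%C * z) / ('i%C ^ (n%:Z - m%:Z) * half_pow z n.-1) +
        (-1) ^+ (n + m) *
        (expc (- ('i%C * z)) / ('i%C ^ (n%:Z - m%:Z) * half_pow z n.-1)))).
Proof.
split=> [m|m z z0]; first by rewrite /besselJ_half lexx schlafli0.
rewrite beta_coef_sum// /besselJ_half; case: ifPn => [Rez|_]; first exact: schlafli_hbessel.
by rewrite bessel_entireE mulrCA half_pow_hbessel_entire.
Qed.
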